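(* Assume that $\alpha\in]0,1[$ and $\alpha+\theta>0$, and let $\widehat{\alpha}_n=K_{1,n}/K_n$ for $n\ge1$. Then $$\lim_{n\to+\infty}\widehat{\alpha}_{n}=\alpha\qquad\text{almost surely.}$$ Moreover, we also have the asymptotic normality $$\sqrt{K_n}\,(\widehat{\alpha}_{n}-\alpha)\xrightarrow[n\to+\infty]{\mathcal{L}}\mathcal{N}(0,\alpha(1-\alpha)),$$ where $\mathcal{N}(0,\alpha(1-\alpha))$ is the centered Gaussian distribution with variance $\alpha(1-\alpha)$.
   Context: Ewens-Pitman model with parameters $\alpha\in[0,1[$ and $\theta>-\alpha$: random partitions $\Pi_n$ of $\{1,\ldots,n\}$, $n\ge1$, built on one probability space as follows. $\Pi_1=\{\{1\}\}$. Given that $\Pi_n$ has $k$ blocks $A_1,\ldots,A_k$ of sizes $n_1,\ldots,n_k$, $\Pi_{n+1}$ is obtained by adding element $n+1$ to block $A_i$ with probability $(n_i-\alpha)/(n+\theta)$, $1\le i\le k$, or as a new singleton block with probability $(\alpha k+\theta)/(n+\theta)$. $K_n$ is the number of blocks of $\Pi_n$, and $K_{r,n}$ is the number of blocks of $\Pi_n$ of size $r$; in particular $K_{1,n}$ is the number of singleton blocks. $\xrightarrow{\mathcal{L}}$ denotes convergence in distribution. *)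

(* Defs.v *)
From mathcomp Require Export all_boot all_order all_algebra.
From mathcomp Require Export all_classical all_reals all_analysis.

Set Implicit Arguments.
Unset Strict Implicit.
Unset Printing Implicit Defensive.

Export Order.TTheory GRing.Theory Num.Theory.
Export numFieldNormedType.Exports.

Local Open Scope ring_scope.

(* The ordinal i : 'I_n stands for the element i + 1 of {1, ..., n}: the new
   element n + 1 is [ord_max : 'I_n.+1], and {1, ..., n} embeds into
   {1, ..., n + 1} through [lift ord_max], which preserves values. *)

Definition embed_block n (A : {set 'I_n}) : {set 'I_n.+1} :=
  [set lift ord_max i | i in A]%SET.

Definition add_to_block n (p : {set {set 'I_n}}) (A : {set 'I_n}) :
    {set {set 'I_n.+1}} :=
  ((ord_max |: embed_block A) |: [set embed_block B | B in p :\ A])%SET.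

Definition add_singleton n (p : {set {set 'I_n}}) : {set {set 'I_n.+1}} :=
  ([set ord_max] |: [set embed_block B | B in p])%SET.

Definition nblocks n (p : {set {set 'I_n}}) : nat := #|p|.

Definition nblocks_of_size (r n : nat) (p : {set {set 'I_n}}) : nat :=
  #|[set A in p | #|A| == r]%SET|.

Local Open Scope classical_set_scope.

(* The transition rules are written in product form,
   P(Pi_{n+1} = q, Pi_n = p) = P(Pi_n = p) * P(Pi_{n+1} = q | Pi_n = p).
   Conditioning on Pi_n alone is conditioning on the whole past, since Pi_n
   almost surely determines Pi_1, ..., Pi_{n-1} by restriction.
   [Pi 0] is unconstrained. *)
Record ewens_pitman (d : measure_display) (T : measurableType d) (R : realType)
    (P : probability T R) (alpha theta : R)
    (Pi : forall n : nat, T -> {set {set 'I_n}}) : Prop := EwensPitman {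
  ewens_pitman_partition : forall (n : nat) (w : T), (0 < n)%N ->
    finset.partition (Pi n w) [set: 'I_n]%SET ;
  ewens_pitman_measurable : forall (n : nat) (p : {set {set 'I_n}}),
    (0 < n)%N -> measurable (Pi n @^-1` [set p]) ;
  ewens_pitman_init : forall w : T, Pi 1%N w = [set [set ord0]]%SET ;
  ewens_pitman_add_to_block :
    forall (n : nat) (p : {set {set 'I_n}}) (A : {set 'I_n}),
    (0 < n)%N -> finset.partition p [set: 'I_n]%SET -> A \in p ->
    P (Pi n @^-1` [set p] `&` Pi n.+1 @^-1` [set add_to_block p A]) =
    (P (Pi n @^-1` [set p]) * ((#|A|%:R - alpha) / (n%:R + theta))%:E)%E ;
  ewens_pitman_add_singleton : forall (n : nat) (p : {set {set 'I_n}}),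
    (0 < n)%N -> finset.partition p [set: 'I_n]%SET ->
    P (Pi n @^-1` [set p] `&` Pi n.+1 @^-1` [set add_singleton p]) =
    (P (Pi n @^-1` [set p]) *
       ((alpha * (nblocks p)%:R + theta) / (n%:R + theta))%:E)%E
}.

(* Meaningful for sequences X that are measurable from some rank on. *)
Definition cvg_in_law (d : measure_display) (T : measurableType d)
    (R : realType) (P : probability T R) (X : nat -> T -> R)
    (mu : probability (measurableTypeR R) R) : Prop :=
  forall f : R -> R, continuous f -> bounded_fun f ->
    ('E_P[f \o X n] @[n --> \oo] --> \int[mu]_x (f x)%:E)%E.

Definition alpha_hat (T : Type) (R : realType)
    (Pi : forall n : nat, T -> {set {set 'I_n}}) (n : nat) (w : T) : R :=
  (nblocks_of_size 1 (Pi n w))%:R / (nblocks (Pi n w))%:R.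

Arguments alpha_hat {T} R Pi n w.

(* Main.v *)
(* Write K for the number of blocks of Pi_n, S for the number of singletons and
   D = S - alpha K.  The law of (K, S) is a Markov chain whose one-step drift
   makes D mean-reverting.

   Almost sure part: W = (D / K)^2 + c / K is, for c large, a nonnegative
   supermartingale contracted at each step by 1 - eta / (n + theta), so E W -> 0
   and the maximal inequality gives W -> 0 almost surely.

   Normal part: X = D / sqrt K moves, up to errors of order E[W]^(1/2) / n that
   are summable, like the Ornstein-Uhlenbeck process with invariant law
   N(0, alpha (1 - alpha)) in logarithmic time.  On cos (s x + phi) the
   Ornstein-Uhlenbeck (Mehler) semigroup is explicit, so the one-step comparison
   telescopes and E cos (s X_n + phi) converges to the Gaussian value.  Since
   E X_n^2 is bounded, test functions can be changed far away, and there any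
   bounded continuous function is uniformly approximated by polynomials in
   sin (k x), which are combinations of the functions cos (s x + phi). *)

Require Import Defs.
From mathcomp Require Import ring lra measurable_realfun normal_distribution.
From mathcomp Require Import lebesgue_integral_under.

Set Implicit Arguments.
Unset Strict Implicit.
Unset Printing Implicit Defensive.

Local Open Scope ring_scope.

(** * Restricting and extending partitions *)

Section Children.
Import boot.finset.
Variable n : nat.
Implicit Types (p : {set {set 'I_n}}) (A B : {set 'I_n}) (q : {set {set 'I_n.+1}}).

(** In units of 1 / (n + theta), K has drift alpha K + theta and S has drift alpha K + theta - (1 -
    alpha) S, so D has drift (1 - alpha) (theta - D); this is why S / K tends to alpha. The obstacle
    to a direct central limit theorem is that K grows like n^alpha times a random factor, so that a
    deterministic normalization would produce a mixture of Gaussian laws. Dividing by sqrt K avoids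
    this: up to terms of order 1 / sqrt K and D / K, X has drift - (1 - alpha / 2) X and
    squared-jump rate alpha (1 - alpha) (2 - alpha), which involve neither K nor n; the second
    coefficient over twice the first is the variance alpha (1 - alpha). Hence no asymptotics of K
    enters, only bounds on E[1 / K] and E[(D / K)^2], and the single function W supplies both. The
    comparison runs backwards from time n to a fixed time m. The semigroup turns a cosine into a
    damped cosine of lower frequency and the same phase, so the family of test functions is stable;
    as the frequency tends to 0 the law at time m is forgotten. *)

Definition trace_block (C : {set 'I_n.+1}) : {set 'I_n} :=
  [set i | lift ord_max i \in C]%SET.

(** The new element alone in its block leaves an empty trace, hence the removal of [set0]. *)
Definition restr_partition q :
  {set {set 'I_n}} := ([set trace_block C | C in q] :\ set0)%SET.

Lemma max_notin_embed A : ord_max \notin embed_block A.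
Proof. by apply/imsetP => -[i _ /eqP]; rewrite (negbTE (neq_lift _ _)). Qed.

Lemma embed_blockK : cancel (@embed_block n) trace_block.
Proof.
by move=> A; apply/setP => i; rewrite inE mem_imset//; exact: lift_inj.
Qed.

Lemma trace_setU1 A : trace_block (ord_max |: embed_block A)%SET = A.
Proof.
rewrite -[RHS]embed_blockK; apply/setP => i; rewrite !inE.
by rewrite eq_sym (negbTE (neq_lift _ _)).
Qed.

Lemma card_embed A : #|embed_block A| = #|A|.
Proof. by rewrite card_imset//; exact: lift_inj. Qed.

Lemma setU1_notin_embed A (P : {pred {set 'I_n}}) :
  (ord_max |: embed_block A)%SET \notin [set embed_block B | B in P]%SET.
Proof.
apply/imsetP => -[B _ AB]; have := max_notin_embed B.
by rewrite -AB !inE eqxx.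
Qed.

(* For a partition p, the empty block thus stands for the opening of a new block,
   so that A in set0 |: p indexes all the transitions from p. *)
Lemma add_to_block0 p : set0 \notin p -> add_to_block p set0 = add_singleton p.
Proof.
move=> p0; rewrite /add_to_block /add_singleton; congr (_ |: _)%SET.
  by rewrite /embed_block imset0 setU0.
suff -> : (p :\ set0)%SET = p by [].
by apply/setP => B; rewrite !inE; case: eqP => // ->; rewrite (negbTE p0).
Qed.

Lemma restr_add_to_block p A : set0 \notin p -> A \in (set0 |: p)%SET ->
  restr_partition (add_to_block p A) = p.
Proof.
move=> p0 Ap; rewrite /restr_partition /add_to_block imsetU1 trace_setU1
  -imset_comp.
rewrite (eq_imset (g := id)); last by move=> B /=; rewrite embed_blockK.
rewrite imset_id; apply/setP => B; rewrite !inE.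
move: Ap; rewrite !inE; case: (eqVneq B set0) => [->|B0] /=.
  by rewrite (negbTE p0).
by case: (eqVneq B A) => //= <-; rewrite (negbTE B0).
Qed.

(** Allows a sum over the children of p to be indexed by [A], each child being counted once. *)
Lemma add_to_block_inj p : injective (add_to_block p).
Proof.
move=> A B AB; have : (ord_max |: embed_block A)%SET \in add_to_block p B.
  by rewrite -AB !inE eqxx.
rewrite in_setU1 (negbTE (setU1_notin_embed _ _)) orbF => /eqP e.
by rewrite -(trace_setU1 A) e trace_setU1.
Qed.

Lemma nblocks_add p A : nblocks (add_to_block p A) = (#|p :\ A|%SET).+1.
Proof.
rewrite /nblocks cardsU1 setU1_notin_embed add1n card_imset//.
exact: can_inj embed_blockK.
Qed.

Lemma nsingle_add p A :
  nblocks_of_size 1 (add_to_block p A) =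
  ((A == set0) + #|[set B in p | #|B| == 1%N] :\ A|)%SET%N.
Proof.
rewrite /nblocks_of_size.
have -> : [set B in add_to_block p A | #|B| == 1%N]%SET =
  ((if A == set0 then [set (ord_max |: embed_block A)%SET] else set0) :|:
   [set embed_block B | B in [set B in p | #|B| == 1%N] :\ A])%SET.
  apply/setP => C; rewrite !inE.
  apply/andP/orP => [[/orP[/eqP->|/imsetP[B]]]|[]].
  - rewrite cardsU1 max_notin_embed card_embed add1n eqSS cards_eq0 => ->.
    by left; rewrite inE.
  - rewrite !inE => /andP[BA Bp] ->; rewrite card_embed => B1; right.
    by apply: imset_f; rewrite !inE BA Bp.
  - case: eqP => [->|_]; rewrite inE// => /eqP->.
    by rewrite eqxx cardsU1 max_notin_embed card_embed cards0.
  - move=> /imsetP[B]; rewrite !inE => /and3P[BA Bp B1] ->.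
    by rewrite card_embed B1; split=> //; rewrite imset_f ?orbT// !inE BA.
case: eqP => A0; last first.
  by rewrite set0U card_imset ?add0n//; exact: can_inj embed_blockK.
rewrite cardsU1 setU1_notin_embed card_imset//; exact: can_inj embed_blockK.
Qed.

End Children.

(** * The one-step transition operator *)

Section Step.
Import boot.finset.
Variables (R : realType) (alpha theta : R).

Definition weight n (p : {set {set 'I_n}}) (A : {set 'I_n}) : R :=
  (if A == set0 then alpha * (nblocks p)%:R + theta else #|A|%:R - alpha) /
  (n%:R + theta).

(** The Markov kernel acting on functions: the conditional expectation of [F] at time n + 1 given
    the partition p at time n. *)
Definition step n (F : {set {set 'I_n.+1}} -> R) (p : {set {set 'I_n}}) : R :=
  \sum_(A in (set0 |: p)%SET) weight p A * F (add_to_block p A).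

Variable n : nat.
Implicit Types p : {set {set 'I_n}}.

Lemma stepE F p : set0 \notin p ->
  step F p = ((alpha * (nblocks p)%:R + theta) * F (add_singleton p) +
    \sum_(A in p) (#|A|%:R - alpha) * F (add_to_block p A)) / (n%:R + theta).
Proof.
move=> p0; rewrite /step big_setU1//= /weight eqxx add_to_block0// [RHS]mulrDl.
congr (_ + _); first by rewrite mulrAC.
rewrite mulr_suml; apply: eq_bigr => A Ap; rewrite ifN 1?mulrAC//.
by apply: contraNneq p0 => <-.
Qed.

Lemma sum_weight p : n%:R + theta != 0 -> partition p [set: 'I_n]%SET ->
  \sum_(A in (set0 |: p)%SET) weight p A = 1.
Proof.
move=> N0 pp; have [_ _ p0] := and3P pp.
transitivity (step (fun=> 1) p).
  by apply: eq_bigr => A _; rewrite mulr1.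
rewrite stepE// mulr1 (eq_bigr (fun A : {set 'I_n} => #|A|%:R - alpha)); last first.
  by move=> A _; rewrite mulr1.
rewrite sumrB sumr_const -natr_sum -(card_partition pp) cardsT card_ord.
rewrite -[X in X / _](_ : n%:R + theta = _) ?divff// /nblocks -(mulr_natr alpha).
by lra.
Qed.

(** Enlarging a block of size at least 2 changes neither K nor S, and such blocks have total weight
    n - alpha K - (1 - alpha) S, again a function of K and S. This closure is what makes (K, S) a
    Markov chain. *)
Lemma step_KS (f : nat -> nat -> R) p : partition p [set: 'I_n]%SET ->
  let K := nblocks p in let S := nblocks_of_size 1 p in
  step (fun q => f (nblocks q) (nblocks_of_size 1 q)) p =
  ((alpha * K%:R + theta) * f K.+1 S.+1 + (1 - alpha) * S%:R * f K S.-1 +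
    (n%:R - alpha * K%:R - (1 - alpha) * S%:R) * f K S) / (n%:R + theta).
Proof.
move=> pp K S; have [_ _ p0] := and3P pp.
rewrite stepE// -add_to_block0// nblocks_add nsingle_add eqxx.
have -> : (p :\ set0)%SET = p.
  by apply/setP => B; rewrite !inE; case: eqP => // ->; rewrite (negbTE p0).
have -> : ([set B in p | #|B| == 1%N] :\ set0)%SET = [set B in p | #|B| == 1%N]%SET.
  by apply/setP => B; rewrite !inE; case: eqP => // ->; rewrite (negbTE p0).
rewrite -addrA add1n; congr ((_ + _) / _).
have fA A : A \in p -> f (nblocks (add_to_block p A)) (nblocks_of_size 1
  (add_to_block p A))
    = f K (if #|A| == 1%N then S.-1 else S).
  move=> Ap; rewrite nblocks_add nsingle_add.
  have -> : (A == set0) = false by apply: contraNF p0 => /eqP <-.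
  rewrite add0n /K /nblocks (cardsD1 A p) Ap add1n.
  congr f; rewrite /S /nblocks_of_size.
  by rewrite [in RHS](cardsD1 A [set _ in _ | _]) !inE Ap /=; case: eqP => _ /=.
under eq_bigr => A Ap do rewrite fA//.
rewrite (bigID (fun A : {set 'I_n} => #|A| == 1%N)) /=; congr (_ + _).
  rewrite (eq_bigr (fun=> (1 - alpha) * f K S.-1)); last first.
    by move=> A /andP[_ /eqP A1]; rewrite A1 eqxx.
  rewrite sumr_const -[LHS]mulr_natr mulrAC; congr (_ * _%:R * _).
  by rewrite /S /nblocks_of_size; apply: eq_card => A; rewrite !inE.
rewrite (eq_bigr (fun A : {set 'I_n} => (#|A|%:R - alpha) * f K S)); last first.
  by move=> A /andP[_ /negbTE A1]; rewrite A1.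
rewrite -mulr_suml; congr (_ * _).
have : \sum_(A in p) (#|A|%:R - alpha) = n%:R - alpha * K%:R.
  rewrite sumrB sumr_const -natr_sum -(card_partition pp) cardsT card_ord.
  by rewrite mulr_natr.
rewrite (bigID (fun A : {set 'I_n} => #|A| == 1%N)) /=.
rewrite [X in X + _ = _](_ : _ = (1 - alpha) * S%:R); first by move=> <-; ring.
rewrite (eq_bigr (fun=> (1 - alpha))); last by move=> A /andP[_ /eqP ->].
rewrite sumr_const -[LHS]mulr_natr; congr (_ * _%:R).
by rewrite /S /nblocks_of_size; apply: eq_card => A; rewrite !inE.
Qed.

Lemma nblocks_gt0 p : (0 < n)%N -> partition p [set: 'I_n]%SET ->
  (0 < nblocks p)%N.
Proof.
move=> n0 pp; rewrite /nblocks card_gt0; apply: contraTneq n0 => p0.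
have /eqP := card_partition pp; rewrite p0 big_set0 cardsT card_ord => /eqP ->.
by [].
Qed.

Lemma nblocks_le p : partition p [set: 'I_n]%SET -> (nblocks p <= n)%N.
Proof.
move=> pp; have [_ _ p0] := and3P pp.
have := card_partition pp; rewrite cardsT card_ord => cp.
rewrite /nblocks (leq_trans _ (eq_leq (esym cp)))// -sum1_card.
apply: leq_sum => A Ap.
by rewrite card_gt0; apply: contraNneq p0 => <-.
Qed.

Lemma nsingle_le p : (nblocks_of_size 1 p <= nblocks p)%N.
Proof.
by apply: subset_leq_card; rewrite subsetE; apply/pred0P => A /=; rewrite !inE;
  case: (A \in p).
Qed.

End Step.

Local Open Scope classical_set_scope.

(** * The law of the partition process *)

Section FiniteValued.
Context (d : measure_display) (T : measurableType d) (R : realType).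
Variables (P : probability T R) (I : finType) (f : T -> I).
Hypothesis mf : forall i, measurable (f @^-1` [set i]).

Lemma measurable_preimage_fin (U : set I) : measurable (f @^-1` U).
Proof.
have -> : f @^-1` U = \big[setU/set0]_(i : I | i \in U) (f @^-1` [set i]).
  apply/seteqP; split=> w /=.
    by move=> Uw; rewrite -bigcup_seq_cond; exists (f w) => //=;
      rewrite mem_index_enum inE.
  by rewrite -bigcup_seq_cond => -[i /= /andP[_]]; rewrite inE => Ui ->.
by apply: bigsetU_measurable => i _; exact: mf.
Qed.

Lemma fine_prob_split A : measurable A ->
  fine (P A) = \sum_i fine (P (A `&` f @^-1` [set i])).
Proof.
move=> mA.
have mAf i : measurable (A `&` f @^-1` [set i]) by exact: measurableI.
rewrite sum_fine; last by move=> i _; rewrite fin_num_measure.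
congr fine; rewrite [RHS]fsbig_seq ?index_enum_uniq//.
rewrite -measure_fin_bigcup//.
  congr (P _); apply/seteqP; split=> w /=; last by case=> i _ [].
  by move=> Aw; exists (f w) => //=; rewrite mem_index_enum.
by apply/trivIsetP => i j _ _ /eqP ij; apply/seteqP;
  split=> // w /= [[_ wi] [_ wj]]; apply: ij; rewrite -wi -wj.
Qed.

Lemma integral_fin_valued (g : I -> R) :
  (\int[P]_w (g (f w))%:E = (\sum_i fine (P (f @^-1` [set i])) * g i)%:E)%E.
Proof.
under eq_integral => w _.
  have -> : (g (f w))%:E =
      (\sum_(i : I) (g i)%:E * (\1_(f @^-1` [set i]) w)%:E)%E.
    rewrite (bigD1 (f w))//= big1 ?adde0; last first.
      by move=> i /eqP fi; rewrite indicE memNset ?mule0// => /= fw; apply: fi.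
    by rewrite indicE mem_set ?mule1.
  over.
have int1 i : P.-integrable setT (fun w => (\1_(f @^-1` [set i]) w)%:E).
  apply/integrableP; split.
    by apply/measurable_EFinP; exact: measurable_indic.
  under eq_integral do rewrite gee0_abs ?lee_fin//.
  by rewrite integral_indic// setIT (le_lt_trans (probability_le1 _ _)) ?ltry.
rewrite integral_sum//=; last by move=> i; apply: integrableZl.
rewrite -sumEFin; apply: eq_bigr => i _.
rewrite integralZl//.
by rewrite integral_indic// setIT EFinM fineK ?fin_num_measure// muleC.
Qed.

End FiniteValued.

Section Process.
Context (d : measure_display) (T : measurableType d) (R : realType).
Variables (P : probability T R) (alpha theta : R).
Variable Pi : forall n : nat, T -> {set {set 'I_n}}.
Hypothesis EP : ewens_pitman P alpha theta Pi.
Hypotheses (alpha_lt1 : alpha < 1) (alpha_theta_gt0 : 0 < alpha + theta).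

Definition law n (p : {set {set 'I_n}}) : R := fine (P (Pi n @^-1` [set p])).

(** The expectation of [F] at Pi_n, as a finite sum: integrability questions disappear until
    [expectation_mean] translates back. *)
Definition mean n (F : {set {set 'I_n}} -> R) : R := \sum_p law p * F p.

Lemma ntheta_gt0 n : (0 < n)%N -> 0 < n%:R + theta.
Proof.
move=> n0; have n1 : 1 <= n%:R :> R by rewrite ler1n.
move: alpha_lt1 alpha_theta_gt0 n1; lra.
Qed.

Lemma law_ge0 n (p : {set {set 'I_n}}) : 0 <= law p.
Proof. by rewrite fine_ge0. Qed.

Lemma law_eq0 n (p : {set {set 'I_n}}) : (0 < n)%N ->
  ~~ finset.partition p [set: 'I_n]%SET -> law p = 0.
Proof.
move=> n0 pp; rewrite /law (_ : _ @^-1` _ = set0) ?measure0//.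
by apply/seteqP; split=> // w /= wp; move: pp;
  rewrite -wp (ewens_pitman_partition EP).
Qed.

Lemma expectation_mean n (g : {set {set 'I_n}} -> R) : (0 < n)%N ->
  ('E_P[fun w => g (Pi n w)] = (mean g)%:E)%E.
Proof.
move=> n0; rewrite unlock integral_fin_valued// => p.
exact: (ewens_pitman_measurable EP).
Qed.

Lemma sum_law n : (0 < n)%N -> \sum_(p : {set {set 'I_n}}) law p = 1.
Proof.
move=> n0; have := fine_prob_split P (fun p =>
  ewens_pitman_measurable EP p n0) measurableT.
by rewrite probability_setT /= => ->; apply: eq_bigr => p _; rewrite setTI.
Qed.

Lemma mean_le n F G : (0 < n)%N ->
  (forall p : {set {set 'I_n}}, finset.partition p [set: 'I_n]%SET -> F p <= G p) ->
  mean F <= mean G.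
Proof.
move=> n0 FG; apply: ler_sum => p _.
have [pp|/law_eq0 ->//] := boolP (finset.partition p [set: 'I_n]%SET).
  by rewrite ler_wpM2l ?law_ge0// FG.
by rewrite !mul0r.
Qed.

Lemma meanD n (F G : {set {set 'I_n}} -> R) :
  mean (fun p => F p + G p) = mean F + mean G.
Proof. by rewrite -big_split /=; apply: eq_bigr => p _; rewrite mulrDr. Qed.

Lemma meanZ n a (F : {set {set 'I_n}} -> R) :
  mean (fun p => a * F p) = a * mean F.
Proof. by rewrite mulr_sumr; apply: eq_bigr => p _; rewrite mulrCA. Qed.

Lemma meanB n (F G : {set {set 'I_n}} -> R) :
  mean (fun p => F p - G p) = mean F - mean G.
Proof. by rewrite -sumrB /=; apply: eq_bigr => p _; rewrite mulrBr. Qed.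

Lemma mean_cst n a : (0 < n)%N -> mean (fun _ : {set {set 'I_n}} => a) = a.
Proof. by move=> n0; rewrite /mean -mulr_suml sum_law// mul1r. Qed.

Lemma mean_norm n (F : {set {set 'I_n}} -> R) :
  `|mean F| <= mean (fun p => `|F p|).
Proof.
apply: le_trans (ler_norm_sum _ _ _) _; apply: ler_sum => p _.
by rewrite normrM ger0_norm ?law_ge0.
Qed.

Let joint n (p : {set {set 'I_n}}) (q : {set {set 'I_n.+1}}) : R :=
  fine (P (Pi n @^-1` [set p] `&` Pi n.+1 @^-1` [set q])).

Let joint_ge0 n p q : 0 <= @joint n p q. Proof. by rewrite fine_ge0. Qed.

Let mPi n (p : {set {set 'I_n}}) : (0 < n)%N -> measurable (Pi n @^-1` [set p]).
Proof. exact: (ewens_pitman_measurable EP). Qed.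

Let joint_suml n p : (0 < n)%N -> \sum_q @joint n p q = law p.
Proof.
move=> n0; rewrite /law (fine_prob_split P (fun p => @mPi n.+1 p _))//.
exact: mPi.
Qed.

Let joint_sumr n q : (0 < n)%N -> \sum_p @joint n p q = law q.
Proof.
move=> n0; rewrite /law (fine_prob_split P (fun p => @mPi n p n0)); last exact: mPi.
by apply: eq_bigr => p _; rewrite /joint setIC.
Qed.

Let joint_child n p A : (0 < n)%N -> finset.partition p [set: 'I_n]%SET ->
  A \in (finset.set0 |: p)%SET ->
  joint p (add_to_block p A) = law p * weight alpha theta p A.
Proof.
move=> n0 pp; have [_ _ p0] := and3P pp.
rewrite /joint /law /weight finset.in_setU1;
  have [->|A0] /= := eqVneq A finset.set0.
  move=> _; rewrite add_to_block0// (ewens_pitman_add_singleton EP)// fineM//.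
  by rewrite fin_num_measure//; exact: mPi.
move=> Ap; rewrite (ewens_pitman_add_to_block EP)// fineM//.
by rewrite fin_num_measure//; exact: mPi.
Qed.

Let joint_sum_child n (p : {set {set 'I_n}}) F :
  (0 < n)%N -> finset.partition p [set: 'I_n]%SET ->
  \sum_(q in [set add_to_block p A | A in (finset.set0 |: p)%SET]%SET)
     joint p q * F q = law p * step alpha theta F p.
Proof.
move=> n0 pp; rewrite big_imset/=; last by move=> A B _ _; exact: add_to_block_inj.
rewrite /step mulr_sumr; apply: eq_bigr => A Ap.
by rewrite joint_child// mulrA.
Qed.

(** The model prescribes only the masses of the children of p. As the weights add up to 1, these
    masses exhaust [law p], and nonnegativity leaves 0 for every other q. *)
Let joint_eq0 n (p : {set {set 'I_n}}) q : (0 < n)%N ->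
  ~~ (finset.partition p [set: 'I_n]%SET &&
    (q \in [set add_to_block p A | A in (finset.set0 |: p)%SET]%SET)) ->
  joint p q = 0.
Proof.
move=> n0; have [pp /= qp|pp _] := boolP (finset.partition p [set: 'I_n]%SET);
  last first.
  apply/eqP; rewrite eq_le joint_ge0 andbT -(law_eq0 n0 pp) -(joint_suml p n0).
  by rewrite (bigD1 q)//= lerDl sumr_ge0.
have := joint_sum_child (fun=> 1) n0 pp.
rewrite [X in _ * X](_ : _ = 1) ?mulr1; last first.
  rewrite -[RHS](sum_weight alpha (theta := theta) _ pp).
    by apply: eq_bigr => A _; rewrite mulr1.
  by rewrite gt_eqF// ntheta_gt0.
under eq_bigr do rewrite mulr1.
rewrite -joint_suml//.
rewrite [RHS](bigID (mem [set add_to_block p A | A in (finset.set0 |: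
  p)%SET]%SET)) /=.
move/eqP; rewrite addrC -subr_eq subrr eq_sym => /eqP.
by move/psumr_eq0P => -> //; move=> i _; exact: joint_ge0.
Qed.

Lemma mean_step n F : (0 < n)%N ->
  mean F = mean (fun p : {set {set 'I_n}} => step alpha theta F p).
Proof.
move=> n0; rewrite /mean.
under eq_bigr => q _ do rewrite -(joint_sumr q n0) mulr_suml.
rewrite exchange_big/=; apply: eq_bigr => p _.
have [pp|pp] := boolP (finset.partition p [set: 'I_n]%SET); last first.
  rewrite law_eq0// mul0r big1// => q _; rewrite joint_eq0 ?mul0r//.
  by rewrite (negbTE pp).
rewrite -joint_sum_child//.
rewrite [LHS](bigID (mem [set add_to_block p A | A in (finset.set0 |:
  p)%SET]%SET)) /=.
by rewrite [X in _ + X]big1 ?addr0// => q qp; rewrite joint_eq0 ?mul0r// pp.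
Qed.

(** A pair (p, q) such that q does not restrict to p is not a possible transition, hence null by
    [joint_eq0]; there are finitely many such pairs for each n, and countably many n. *)
Lemma ae_restr_partition :
  {ae P, forall w, forall n, (0 < n)%N -> restr_partition (Pi n.+1 w) = Pi n w}.
Proof.
apply/ae_foralln => n.
have [->|n0] := posnP n; first exact: aeW.
pose B := [set w | restr_partition (Pi n.+1 w) != Pi n w].
have mB : measurable B.
  have mpq : measurable (\big[setU/set0]_p \big[setU/set0]_(q | restr_partition
    q != p)
      (Pi n @^-1` [set p] `&` Pi n.+1 @^-1` [set q])).
    apply: bigsetU_measurable => p _; apply: bigsetU_measurable => q _.
    by apply: measurableI; exact: mPi.
  rewrite (_ : B = \big[setU/set0]_p \big[setU/set0]_(q | restr_partition q != p)
      (Pi n @^-1` [set p] `&` Pi n.+1 @^-1` [set q]))//.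
  apply/seteqP; split=> w /=.
    move=> Bw; rewrite -bigcup_seq; exists (Pi n w);
      first by rewrite /= mem_index_enum.
    rewrite -bigcup_seq_cond; exists (Pi n.+1 w) => //=.
    by rewrite mem_index_enum.
  rewrite -bigcup_seq => -[p _]; rewrite -bigcup_seq_cond => -[q /= /andP[_]].
  by move=> qp [wp wq]; rewrite /B /= wp wq.
exists B; split=> //; last by move=> w /= h; apply/eqP => e; apply: h.
apply/eqP; rewrite -[_ == _]fine_eq0 ?fin_num_measure//.
rewrite (fine_prob_split P (fun p => @mPi n p n0))// big1// => p _.
rewrite (fine_prob_split P (fun p => @mPi n.+1 p _))//; last first.
  by apply: measurableI => //; exact: mPi.
rewrite big1// => q _.
have mI := measurableI _ _ (mPi p n0) (@mPi n.+1 q (ltn0Sn n)).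
have [qp|qp] := eqVneq (restr_partition q) p.
  rewrite (_ : _ `&` _ = set0) ?measure0//; apply/seteqP; split => // w /=.
  by rewrite /B /= => -[[/eqP + wp] wq]; rewrite wp wq qp.
apply/eqP; rewrite eq_le fine_ge0// andbT.
have <- : joint p q = 0.
  apply: joint_eq0 => //; apply: contra qp => /andP[pp /imsetP[A Ap ->]].
  by have [_ _ p0] := and3P pp; rewrite restr_add_to_block.
rewrite fine_le ?fin_num_measure//.
  by apply: measurableI; [apply: measurableI|]; rewrite //; exact: mPi.
by rewrite le_measure ?inE//; [apply: measurableI; [apply: measurableI|];
  rewrite //; exact: mPi|move=> w /= [[]]].
Qed.

End Process.

(** * Drift of functions of the block counts *)

Section Generator.
Variables (R : realType) (alpha theta : R).
Implicit Types (h : R -> R -> R) (x D : R).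

Definition stat h n (p : {set {set 'I_n}}) : R :=
  h (nblocks p)%:R ((nblocks_of_size 1 p)%:R - alpha * (nblocks p)%:R).

(* n + theta times the expected one-step increment of h (K, D). *)
Definition drift h x D : R :=
  (alpha * x + theta) * (h (x + 1) (D + 1 - alpha) - h x D) +
  (1 - alpha) * (alpha * x + D) * (h x (D - 1) - h x D).

(** Since [alpha * x + D] is the number S of singletons, the constraints are 1 <= K <= n and 0 <= S
    <= K. *)
Definition admissible (n : nat) x D : Prop :=
  [/\ 1 <= x, x <= n%:R, 0 <= alpha * x + D & alpha * x + D <= x].

Lemma admissible_stat n (p : {set {set 'I_n}}) : (0 < n)%N ->
  finset.partition p [set: 'I_n]%SET ->
  admissible n (nblocks p)%:R
    ((nblocks_of_size 1 p)%:R - alpha * (nblocks p)%:R).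
Proof.
move=> n0 pp; split.
- by rewrite ler1n nblocks_gt0.
- by rewrite ler_nat nblocks_le.
- by rewrite addrC subrK ler0n.
- by rewrite addrC subrK ler_nat nsingle_le.
Qed.

Lemma step_stat h n (p : {set {set 'I_n}}) : n%:R + theta != 0 ->
  finset.partition p [set: 'I_n]%SET ->
  step alpha theta (@stat h n.+1) p =
  stat h p + drift h (nblocks p)%:R
    ((nblocks_of_size 1 p)%:R - alpha * (nblocks p)%:R) / (n%:R + theta).
Proof.
move=> N0 pp.
rewrite (step_KS alpha theta (fun k s => h k%:R (s%:R - alpha * k%:R)) pp).
rewrite /drift /stat; set K := nblocks p; set S := nblocks_of_size 1 p.
(* The truncated predecessor at S = 0 is harmless, because the factor S vanishes. *)
have -> : (1 - alpha) * S%:R * h K%:R (S.-1%:R - alpha * K%:R) =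
          (1 - alpha) * S%:R * h K%:R (S%:R - alpha * K%:R - 1).
  by case: S => [|s]; [rewrite !(mulr0, mul0r)|congr (_ * h _ _);
    rewrite -natr1; ring].
rewrite -!natr1.
have -> : S%:R + 1 - alpha * (K%:R + 1) = S%:R - alpha * K%:R + 1 - alpha :> R
  by ring.
by field.
Qed.

End Generator.

(** * Drift inequalities for (D / K)^2 + c / K and D^2 / K *)

Section Lyapunov.
Variables (R : realType) (alpha theta : R).
Hypotheses (alpha_gt0 : 0 < alpha) (alpha_lt1 : alpha < 1).
Hypothesis alpha_theta_gt0 : 0 < alpha + theta.

Let beta := Num.min alpha (alpha + theta).

Let beta_gt0 : 0 < beta. Proof. by rewrite lt_min alpha_gt0. Qed.

Let beta_le1 : beta <= 1.
Proof. by rewrite ge_min (ltW alpha_lt1). Qed.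

Let beta_leD : beta <= alpha + theta.
Proof. by rewrite ge_min lexx orbT. Qed.

(* The probability to open a block is at least beta K / (n + theta), also for
   theta < 0. *)
Lemma new_rate_ge x : 1 <= x -> beta * x <= alpha * x + theta.
Proof.
move=> x1; have := beta_leD; have : beta <= alpha by rewrite ge_min lexx.
have [t0|t0] := leP 0 theta; move=> b1 b2; nra.
Qed.

(** The sum of the three errors 2 (1 + |theta|), 1 + |theta| and 1 met in [drift_sqr_ratio]. *)
Let C := 3 * `|theta| + 4.

(* Makes the drift of lyap_cst / x, at most - beta lyap_cst / (2 x), twice the
   error term C / x of drift_sqr_ratio. *)
Definition lyap_cst := 4 * C / beta.

Definition lyap (x D : R) := (D / x) ^+ 2 + lyap_cst / x.

Let C_gt0 : 0 < C. Proof. by rewrite /C; have := normr_ge0 theta; lra. Qed.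

Lemma lyap_cst_gt0 : 0 < lyap_cst.
Proof. by rewrite divr_gt0// mulr_gt0. Qed.

(** What remains of the drift of [lyap_cst / x] once half of it has absorbed the error [C / x]: C =
    (beta / 4) [lyap_cst]. *)
Definition lyap_rate := beta / 4.

Lemma lyap_rate_gt0 : 0 < lyap_rate. Proof. by rewrite divr_gt0. Qed.

Lemma lyap_rate_lt n : (0 < n)%N -> lyap_rate < n%:R + theta.
Proof.
move=> n0; have n1 : 1 <= n%:R :> R by rewrite ler1n.
rewrite /lyap_rate; move: beta_leD beta_gt0 alpha_lt1 alpha_theta_gt0 n1.
by move: (beta) => b; lra.
Qed.

(* With u = D / x, the terms of order 1 of the drift of u^2 add up to - 2 u^2. *)
Lemma drift_sqr_ratio x D : 1 <= x -> 0 <= alpha * x + D -> alpha * x + D <= x ->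
  drift alpha theta (fun x D => (D / x) ^+ 2) x D <= - 2 * (D / x) ^+ 2 + C / x.
Proof.
move=> x1 D0 Dx; have x0 : 0 < x by lra.
have [a0 a1] := (alpha_gt0, alpha_lt1).
have [u Du] : exists u, D = u * x by exists (D / x); rewrite divfK ?gt_eqF.
have u0 : 0 <= alpha + u by rewrite Du -mulrDl pmulr_lge0 in D0.
have u1 : alpha + u <= 1 by rewrite Du -mulrDl ger_pMl in Dx.
have xn0 : x != 0 by rewrite gt_eqF.
have x1n0 : x + 1 != 0 by rewrite gt_eqF// addr_gt0.
rewrite /drift (_ : D / x = u); last by rewrite Du mulfK.
rewrite Du.
rewrite [leLHS](_ : _ = - 2 * u ^+ 2 +
   (2 * u * (1 - alpha - u) * (theta - alpha) * (x + 1)^-1 +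
   (1 - alpha - u) ^+ 2 * ((alpha * x + theta) / (x + 1)) * (x + 1)^-1 +
   (1 - alpha) * (alpha + u) / x)); last by field; rewrite ?xn0 ?x1n0.
rewrite lerD2l.
have y0 : 0 < x^-1 by rewrite invr_gt0.
have yx : (x + 1)^-1 <= x^-1 by rewrite lef_pV2 ?posrE// ?addr_gt0// lerDl.
have y1 : 0 < (x + 1)^-1 by rewrite invr_gt0 addr_gt0.
have tt : theta <= `|theta| by exact: ler_norm.
have tt' : - theta <= `|theta| by rewrite -normrN ler_norm.
have tp := normr_ge0 theta.
set y := (x + 1)^-1 in yx y1 *.
have r1 : (alpha * x + theta) * y <= 1 + `|theta|.
  rewrite /y ler_pdivrMr ?addr_gt0//.
  have : alpha * x <= x by rewrite ger_pMl// ltW.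
  have : 0 <= `|theta| * x by rewrite mulr_ge0// ltW.
  by nra.
have r0 : 0 <= (alpha * x + theta) * y.
  by rewrite mulr_ge0 ?ltW//; apply: lt_le_trans (new_rate_ge x1); rewrite mulr_gt0.
have b1 : 2 * u * (1 - alpha - u) * (theta - alpha) * y <= 2 * (1 + `|theta|) / x.
  have e1 : `|u * (1 - alpha - u)| <= 1.
    rewrite normrM mulr_ile1 ?normr_ge0//; rewrite ler_norml; lra.
  have e2 : `|theta - alpha| <= 1 + `|theta|.
    by rewrite ler_norml; lra.
  apply: le_trans (ler_norm _) _.
  rewrite (_ : 2 * u * _ * _ * y = 2 * ((u * (1 - alpha - u)) * (theta -
    alpha)) * y); last by ring.
  rewrite normrM (gtr0_norm y1); apply: ler_pM; rewrite ?normr_ge0 ?(ltW y1)//.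
  rewrite normrM (ger0_norm (ler0n _ 2)) ler_pM2l//.
  by rewrite normrM -[leRHS]mul1r; apply: ler_pM.
have b2 : (1 - alpha - u) ^+ 2 * ((alpha * x + theta) * y) * y <= (1 +
  `|theta|) / x.
  apply: ler_pM => //; [by rewrite mulr_ge0// sqr_ge0|exact: ltW|].
  rewrite -[leRHS]mul1r; apply: ler_pM => //; first exact: sqr_ge0.
  by rewrite expr_le1//; lra.
have b3 : (1 - alpha) * (alpha + u) / x <= 1 / x.
  rewrite ler_pM2r//; nra.
rewrite /C; apply: le_trans (lerD (lerD b1 b2) b3) _.
rewrite -!mulrDl ler_pM2r//; lra.
Qed.

Lemma drift_lyap n x D : admissible alpha n x D ->
  drift alpha theta lyap x D <= - lyap_rate * lyap x D.
Proof.
case=> x1 _ D0 Dx; have x0 : 0 < x by lra.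
have := drift_sqr_ratio x1 D0 Dx.
have -> : drift alpha theta lyap x D = drift alpha theta (fun x D =>
  (D / x) ^+ 2) x D
   - (alpha * x + theta) * (lyap_cst / (x * (x + 1))).
  have xn0 : x != 0 by rewrite gt_eqF.
  have x1n0 : x + 1 != 0 by rewrite gt_eqF// addr_gt0.
  by rewrite /drift /lyap; field; rewrite ?xn0 ?x1n0.
(* The opening rate is at least beta x, and x / (x + 1) >= 1 / 2 since x >= 1. *)
have : 2 * C / x <= (alpha * x + theta) * (lyap_cst / (x * (x + 1))).
  rewrite [leRHS](_ : _ = (alpha * x + theta) / beta * (x + 1)^-1 * (4 * C) /
    x); last first.
    rewrite /lyap_cst; field.
    by rewrite !gt_eqF// addr_gt0.
  rewrite ler_pM2r ?invr_gt0// (_ : 2 * C = 2^-1 * (4 * C)); last by field.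
  rewrite ler_pM2r; last by rewrite mulr_gt0.
  rewrite ler_pdivlMr ?addr_gt0// ler_pdivlMr//.
  apply: le_trans (new_rate_ge x1).
  have := beta_gt0; move: (beta) => b; nra.
rewrite [in X in _ -> _ -> X]mulNr.
have -> : lyap_rate * lyap x D = lyap_rate * (D / x) ^+ 2 + C / x.
  rewrite mulrDr; congr (_ + _); rewrite /lyap_rate /lyap_cst; field.
  by rewrite !gt_eqF.
have : lyap_rate * (D / x) ^+ 2 <= 2 * (D / x) ^+ 2.
  by rewrite ler_wpM2r ?sqr_ge0// /lyap_rate; have := beta_le1;
    move: (beta) => b; lra.
have key (a b c e g : R) : a <= 2 * b -> 2 * c <= g -> e <= - 2 * b + c ->
  e - g <= - (a + c) by lra.
by rewrite -(mulrA 2); exact: key.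
Qed.

(** The sum of the errors 1, 4 (1 + |theta|) and 1 in the next lemma. *)
Let C' := 4 * `|theta| + 6.

(** Provides the bound on E X_n^2. The true leading coefficient is - (2 - alpha); it is relaxed to -
    (1 - alpha) so that 1 - (1 - alpha) / (n + theta) is nonnegative from n = 1 on, thanks to alpha
    + theta > 0. *)
Lemma drift_sqr_normalized n x D : admissible alpha n x D ->
  drift alpha theta (fun x D => D ^+ 2 / x) x D <=
  - (1 - alpha) * (D ^+ 2 / x) + C'.
Proof.
case=> x1 _ D0 Dx; have x0 : 0 < x by lra.
have [a0 a1] := (alpha_gt0, alpha_lt1).
have [u Du] : exists u, D = u * x by exists (D / x); rewrite divfK ?gt_eqF.
have u0 : 0 <= alpha + u by rewrite Du -mulrDl pmulr_lge0 in D0.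
have u1 : alpha + u <= 1 by rewrite Du -mulrDl ger_pMl in Dx.
have xn0 : x != 0 by rewrite gt_eqF.
have x1n0 : x + 1 != 0 by rewrite gt_eqF// addr_gt0.
rewrite /drift Du.
rewrite [leLHS](_ : _ = - (2 - alpha) * (u ^+ 2 * x) + (alpha * (1 - alpha) ^+ 2 +
   (theta - alpha) * ((2 * (1 - alpha) * u * x + (1 - alpha) ^+ 2 - u ^+ 2 * x)
     / (x + 1)) +
   (1 - alpha) * (alpha + u))); last by field; rewrite ?xn0 ?x1n0.
rewrite (_ : (u * x) ^+ 2 / x = u ^+ 2 * x); last by field.
have ux : 0 <= u ^+ 2 * x by rewrite mulr_ge0 ?sqr_ge0 ?ltW.
have tt : theta <= `|theta| by exact: ler_norm.
have tt' : - theta <= `|theta| by rewrite -normrN ler_norm.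
have tp := normr_ge0 theta.
apply: lerD; first by rewrite !mulNr lerN2 ler_wpM2r//; lra.
have uu : u ^+ 2 <= 1
  by rewrite -[leRHS](expr1n _ 2) -real_normK ?num_real// ler_pXn2r ?nnegrE//
  ler_norml; lra.
have b1 : (theta - alpha) * ((2 * (1 - alpha) * u * x + (1 - alpha) ^+ 2 - u ^+
  2 * x) / (x + 1))
    <= (1 + `|theta|) * 4.
  apply: le_trans (ler_norm _) _; rewrite normrM; apply: ler_pM => //.
    by rewrite ler_norml; lra.
  rewrite normrM normfV (gtr0_norm (addr_gt0 x0 ltr01)) ler_pdivrMr ?addr_gt0//.
  have a2 : (1 - alpha) ^+ 2 <= 1 by rewrite expr_le1//; lra.
  have a20 := sqr_ge0 (1 - alpha).
  have au1 : (1 - alpha) * u <= 1 by nra.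
  have au2 : -1 <= (1 - alpha) * u by nra.
  rewrite (_ : 2 * (1 - alpha) * u * x = 2 * ((1 - alpha) * u * x)); last by ring.
  move: ((1 - alpha) * u) au1 au2 => b au1 au2.
  move: (u ^+ 2) uu ux ((1 - alpha) ^+ 2) a2 a20 => w uu ux a a2 a20.
  rewrite ler_norml; apply/andP; split; nra.
rewrite /C'.
have a3 : alpha * (1 - alpha) ^+ 2 <= 1.
  by rewrite mulr_ile1 ?sqr_ge0 ?ltW// expr_lt1 ?subr_ge0 ?ltW//; lra.
have a4 : (1 - alpha) * (alpha + u) <= 1 by nra.
lra.
Qed.

(** The value at which the drift bound - (1 - alpha) m + C' vanishes, hence a barrier for the
    recursion on m = E X_n^2. *)
Definition var_bound := C' / (1 - alpha).

Lemma var_boundE : (1 - alpha) * var_bound = C'.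
Proof. by rewrite /var_bound mulrC divfK// gt_eqF// subr_gt0. Qed.

Lemma var_bound_ge1 : 1 <= var_bound.
Proof.
rewrite ler_pdivlMr ?subr_gt0// mul1r /C'.
by have := normr_ge0 theta; move: alpha_gt0; lra.
Qed.

End Lyapunov.

(** * Decay of moments *)

Section Decay.
Variables (R : realType) (theta : R).
Implicit Types a : R.

(** The solution of y_{n+1} = (1 - a / (n + theta)) y_n with y_m = 1, a discrete version of the
    power ((n + theta) / (m + theta))^(-a). *)
Definition decay a m n : R := \prod_(m <= k < n) (1 - a / (k%:R + theta)).

Lemma decay_recr a m n : (m <= n)%N ->
  decay a m n.+1 = decay a m n * (1 - a / (n%:R + theta)).
Proof. by move=> mn; rewrite /decay big_nat_recr. Qed.

Lemma decay_ge0 a m n : 0 < m%:R + theta -> a <= m%:R + theta -> 0 <= decay a m n.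
Proof.
move=> m0 am; rewrite /decay big_seq; apply: prodr_ge0 => k.
rewrite mem_index_iota => /andP[mk _].
have : (m%:R : R) <= k%:R by rewrite ler_nat.
by rewrite subr_ge0 => mk'; rewrite ler_pdivrMr; lra.
Qed.

Lemma decay_gt0 a m n : 0 < m%:R + theta -> a < m%:R + theta -> 0 < decay a m n.
Proof.
move=> m0 am; rewrite /decay big_seq; apply: prodr_gt0 => k.
rewrite mem_index_iota => /andP[mk _].
have : (m%:R : R) <= k%:R by rewrite ler_nat.
by rewrite subr_gt0 => mk'; rewrite ltr_pdivrMr; lra.
Qed.

(** Each factor is at most exp (- a / (k + theta)), and 1 / N >= ln (N + 1) - ln N makes the
    exponents telescope. *)
Lemma decay_le_exp a m n :
  0 < m%:R + theta -> 0 <= a -> a <= m%:R + theta -> (m <= n)%N ->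
  decay a m n <= expR (a * (ln (m%:R + theta) - ln (n%:R + theta))).
Proof.
move=> m0 a0 am; elim: n => [|n IH].
  by rewrite leqn0 => /eqP ->; rewrite /decay big_geq// subrr mulr0 expR0.
rewrite leq_eqVlt => /orP[/eqP <-|].
  by rewrite /decay big_geq// subrr mulr0 expR0.
rewrite ltnS => mn; have mn' : (m%:R : R) <= n%:R by rewrite ler_nat.
have N0 : 0 < n%:R + theta by lra.
have -> : a * (ln (m%:R + theta) - ln (n.+1%:R + theta)) =
  a * (ln (m%:R + theta) - ln (n%:R + theta)) + - (a * (ln (n.+1%:R + theta) -
    ln (n%:R + theta))) by ring.
rewrite decay_recr// expRD; apply: ler_pM; rewrite ?decay_ge0 ?IH//.
  by rewrite subr_ge0 ler_pdivrMr//; lra.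
apply: le_trans (expR_ge1Dx _); rewrite lerD2l lerN2 ler_wpM2l//.
have N1 : 0 < n.+1%:R + theta by rewrite -natr1; lra.
rewrite -ln_div ?posrE//.
have -> : (n.+1%:R + theta) / (n%:R + theta) = 1 + (n%:R + theta)^-1.
  by rewrite -natr1 addrAC mulrDl divff ?gt_eqF// mul1r.
rewrite -[leRHS]expRK ler_ln ?posrE ?expR_gt0 ?expR_ge1Dx//.
by rewrite addr_gt0// invr_gt0.
Qed.

Lemma cvg_decay a m : 0 < m%:R + theta -> 0 < a -> a <= m%:R + theta ->
  decay a m n @[n --> \oo] --> 0.
Proof.
move=> m0 a0 am; apply/cvgrPdist_le => e e0.
near=> n.
have mn : (m <= n)%N by near: n; exact: nbhs_infty_ge.
have mn' : (m%:R : R) <= n%:R by rewrite ler_nat.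
rewrite sub0r normrN ger0_norm ?decay_ge0//.
apply: le_trans (decay_le_exp m0 (ltW a0) am mn) _.
rewrite -[leRHS](lnK e0) ler_expR mulrC -ler_pdivlMr// lerBlDr -lerBlDl.
rewrite -[leLHS]expRK ler_ln ?posrE ?expR_gt0//; last by lra.
rewrite -lerBlDr; near: n; exact: nbhs_infty_ger.
Unshelve. all: by end_near. Qed.

End Decay.

Section Bounds.
Context (d : measure_display) (T : measurableType d) (R : realType).
Variables (P : probability T R) (alpha theta : R).
Variable Pi : forall n : nat, T -> {set {set 'I_n}}.
Hypothesis EP : ewens_pitman P alpha theta Pi.
Hypotheses (alpha_gt0 : 0 < alpha) (alpha_lt1 : alpha < 1).
Hypothesis alpha_theta_gt0 : 0 < alpha + theta.

Local Notation eta := (lyap_rate alpha theta).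
Local Notation lyapf := (lyap alpha theta).
Local Notation w := (decay theta (eta / 2) 1).
Local Notation mean := (mean P Pi).
Local Notation stat := (@stat R alpha).

Lemma mean_stat_step h n : (0 < n)%N ->
  mean (@stat h n.+1) = mean (@stat h n) +
   mean (fun p : {set {set 'I_n}} => drift alpha theta h (nblocks p)%:R
    ((nblocks_of_size 1 p)%:R - alpha * (nblocks p)%:R)) / (n%:R + theta).
Proof.
move=> n0; rewrite (mean_step EP)// mulrC -meanZ -meanD.
apply: eq_bigr => p _.
have [pp|pp] := boolP (finset.partition p [set: 'I_n]%SET); last first.
  by rewrite (law_eq0 EP)// !mul0r.
rewrite step_stat//; first by rewrite [_ / _]mulrC.
by rewrite gt_eqF// (ntheta_gt0 alpha_lt1).
Qed.

Lemma ntheta1 : 0 < 1 + theta. Proof. by move: alpha_lt1 alpha_theta_gt0; lra. Qed.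

Let eta_gt0 := lyap_rate_gt0 alpha_gt0 alpha_theta_gt0.
Let eta_lt n (n0 : (0 < n)%N) := lyap_rate_lt alpha_gt0 alpha_lt1
  alpha_theta_gt0 n0.

Lemma mean1_le a h : (forall x D, admissible alpha 1 x D -> h x D <= a) ->
  mean (@stat h 1) <= a.
Proof.
move=> h1; rewrite -[leRHS](mean_cst EP a (ltn0Sn 0)).
by apply: (mean_le EP) => // p pp; apply: h1; exact: admissible_stat.
Qed.

Lemma mean_drift_le n h g : (0 < n)%N ->
  (forall x D, admissible alpha n x D -> drift alpha theta h x D <= g x D) ->
  mean (@stat h n.+1) <= mean (@stat h n) + mean (@stat g n) / (n%:R + theta).
Proof.
move=> n0 hg; rewrite mean_stat_step// lerD2l ler_pM2r; last first.
  by rewrite invr_gt0 (ntheta_gt0 alpha_lt1).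
by apply: (mean_le EP) => // p pp; apply: hg; exact: admissible_stat.
Qed.

(* The bound is a square because the comparison of oscillations needs decay rate
   w for K^(-1/2) and |D| / K. *)
Lemma mean_lyap n : (0 < n)%N ->
  mean (@stat lyapf n) <= (1 + lyap_cst alpha theta) * w n ^+ 2.
Proof.
have c0 := lyap_cst_gt0 alpha_gt0 alpha_theta_gt0.
elim: n => // -[_ _|n IH _].
  rewrite /decay big_geq// expr1n mulr1; apply: mean1_le => x D [x1 _ D0 Dx].
  apply: lerD; last by rewrite ler_pdivrMr ?(lt_le_trans ltr01)// ler_peMr// ltW.
  have x0 : 0 < x by lra.
  rewrite -real_normK ?num_real// expr_le1// normf_div (gtr0_norm x0)
    ler_pdivrMr// mul1r.
  have [a0 a1] := (alpha_gt0, alpha_lt1).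
  by rewrite ler_norml; apply/andP; split; nra.
have N0 : 0 < n.+1%:R + theta by exact: (ntheta_gt0 alpha_lt1).
have Nn0 := lt0r_neq0 N0.
apply: le_trans (mean_drift_le (g := fun x D => - eta * lyapf x D) (ltn0Sn n) _) _.
  by move=> x D; exact: drift_lyap.
rewrite [X in _ + X / _](_ : _ = - eta * mean (@stat lyapf n.+1)); last first.
  by rewrite -meanZ.
rewrite [leLHS](_ : _ = mean (@stat lyapf n.+1) * (1 - eta / (n.+1%:R +
  theta))); last first.
  by move: (n.+1%:R + theta) Nn0 => N Nn0; field.
rewrite decay_recr// exprMn mulrA; apply: ler_pM => //.
- rewrite -[leLHS](mean_cst EP 0 (ltn0Sn n)); apply: (mean_le EP) => // p pp.
  rewrite /stat /lyap addr_ge0 ?sqr_ge0// divr_ge0// ltW//.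
- by rewrite subr_ge0 ler_pdivrMr// mul1r ltW// eta_lt.
- exact: IH.
(* Halving the rate is safe: the square of 1 - eta / (2 N) exceeds 1 - eta / N by a square. *)
rewrite [leRHS](_ : _ = 1 - eta / (n.+1%:R + theta) + (eta / 2 / (n.+1%:R +
  theta)) ^+ 2).
  by rewrite lerDl sqr_ge0.
by move: (n.+1%:R + theta) Nn0 => N Nn0; field.
Qed.

Lemma mean_var n : (0 < n)%N ->
  mean (@stat (fun x D => D ^+ 2 / x) n) <= var_bound alpha theta.
Proof.
elim: n => // -[_ _|n IH _].
  apply: mean1_le => x D [x1 x1' D0 Dx];
    apply: le_trans (var_bound_ge1 theta alpha_gt0 alpha_lt1).
  have [a0 a1] := (alpha_gt0, alpha_lt1).
  rewrite (_ : x = 1) in D0 Dx *; last by apply/eqP; rewrite eq_le x1 x1'.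
  rewrite divr1 -real_normK ?num_real// expr_le1//.
  by rewrite ler_norml; apply/andP; split; lra.
have N0 : 0 < n.+1%:R + theta by exact: (ntheta_gt0 alpha_lt1).
have Nn0 := lt0r_neq0 N0.
apply: le_trans (mean_drift_le
    (g := fun x D => - (1 - alpha) * (D ^+ 2 / x) + (4 * `|theta| + 6)) (ltn0Sn
      n) _) _.
  by move=> x D; exact: drift_sqr_normalized.
rewrite -(var_boundE theta alpha_lt1).
rewrite [X in _ + X / _](_ :
  _ = (1 - alpha) * (var_bound alpha theta - mean (@stat (fun x D =>
  D ^+ 2 / x) n.+1))); last first.
  rewrite -[X in _ * (X - _)](mean_cst EP (var_bound alpha theta) (ltn0Sn n)).
  rewrite -meanB -meanZ; apply: eq_bigr => p _; congr (_ * _).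
  by rewrite /stat mulNr mulrBr addrC.
have := IH (ltn0Sn n); set m := mean _; set v := var_bound _ _ => mv.
(* The gap v - m between the barrier and the moment is multiplied by 1 - (1 - alpha) / (n + 1 +
   theta) >= 0, hence keeps its sign. *)
rewrite -subr_ge0 (_ :
  _ - _ = (v - m) * (1 - (1 - alpha) / (n.+1%:R + theta))); last first.
  by move: (n.+1%:R + theta) Nn0 => N Nn0; field.
rewrite mulr_ge0 ?subr_ge0// ler_pdivrMr// mul1r.
have : (1 : R) <= n.+1%:R by rewrite ler1n.
by move: alpha_theta_gt0; lra.
Qed.

End Bounds.

(** * Almost sure convergence *)

Section Maximal.
Context (d : measure_display) (T : measurableType d) (R : realType).
Variables (P : probability T R) (alpha theta : R).
Variable Pi : forall n : nat, T -> {set {set 'I_n}}.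
Hypothesis EP : ewens_pitman P alpha theta Pi.
Hypotheses (alpha_gt0 : 0 < alpha) (alpha_lt1 : alpha < 1).
Hypothesis alpha_theta_gt0 : 0 < alpha + theta.

Variable W : forall n, {set {set 'I_n}} -> R.
Hypothesis W_ge0 : forall n p, (0 < n)%N -> 0 <= @W n p.
Hypothesis W_super : forall n (p : {set {set 'I_n}}), (0 < n)%N ->
  finset.partition p [set: 'I_n]%SET -> step alpha theta (@W n.+1) p <= W p.

(* W stopped when it reaches e at or after time m.  Only the joint law of
   consecutive partitions is known, but the past is recovered from the present by
   restriction, so the stopped process is a function of the current partition. *)
Fixpoint stopped (e : R) (m n : nat) : {set {set 'I_n}} -> R :=
  match n with
  | 0 => @W 0
  | n'.+1 => fun q =>
      if (n' < m)%N then W q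
      else let u := stopped e m (restr_partition q) in if e <= u then u else W q
  end.

(** A frozen value is at least [e], so a value below [e] means that nothing has been frozen yet. *)
Let stopped_le e m n (p : {set {set 'I_n}}) : (m <= n)%N ->
  stopped e m p < e -> stopped e m p = W p.
Proof.
case: n p => //= n p _; case: ifP => // _; case: ifPn => //.
by rewrite ltNge => ->.
Qed.

Lemma stopped_ge0 e m n (p : {set {set 'I_n}}) : (0 < n)%N -> 0 <= e ->
  0 <= stopped e m p.
Proof.
case: n p => //= n p _ e0; case: ifP => _; first exact: W_ge0.
by case: ifPn => [|_]; [exact: le_trans|exact: W_ge0].
Qed.

(** Optional stopping, one step at a time. If the value at p is at least [e], all children of p
    inherit it, since they restrict to p, and the weights add up to 1; otherwise the process is
    still [W] and [W_super] applies. *)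
Lemma mean_stopped_le e m n : (0 < m)%N -> (m <= n)%N ->
  mean P Pi (@stopped e m n) <= mean P Pi (@W m).
Proof.
move=> m0; elim: n => [|n IH]; first by rewrite leqn0 => /eqP m0';
  rewrite m0' in m0.
rewrite leq_eqVlt => /orP[/eqP ->|].
  by apply: (mean_le EP) => // p pp /=; rewrite ltnSn.
rewrite ltnS => mn; apply: le_trans (IH mn).
have n0 : (0 < n)%N by exact: leq_trans mn.
rewrite (mean_step EP)//; apply: (mean_le EP) => // p pp.
have [_ _ p0] := and3P pp.
have [eu|ue] := leP e (stopped e m p).
  rewrite /step (eq_bigr (fun A => weight alpha theta p A * stopped e m p)).
    rewrite -mulr_suml sum_weight ?mul1r//.
    by rewrite gt_eqF// (ntheta_gt0 alpha_lt1).
  by move=> A Ap; rewrite /= ltnNge mn /= restr_add_to_block// eu.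
rewrite (stopped_le mn ue); apply: le_trans (W_super n0 pp).
rewrite /step le_eqVlt; apply/orP; left; apply/eqP/eq_bigr => A Ap.
by rewrite /= ltnNge mn /= restr_add_to_block// leNgt ue.
Qed.

Definition exceed (e : R) (m n : nat) : set T :=
  [set w | exists k, [/\ (m <= k)%N, (k <= n)%N & e <= W (Pi k w)]].

Let mPi n (U : set {set {set 'I_n}}) : (0 < n)%N -> measurable (Pi n @^-1` U).
Proof.
move=> n0; apply: measurable_preimage_fin => p.
exact: (ewens_pitman_measurable EP).
Qed.

Lemma measurable_exceed e m n : (0 < m)%N -> measurable (exceed e m n).
Proof.
move=> m0.
rewrite (_ : exceed e m n = \bigcup_(k in [set k | (m <= k <= n)%N])
  (Pi k @^-1` [set p | e <= W p])); last first.
  apply/seteqP; split=> w /=.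
    by move=> [k [mk kn ek]]; exists k => //=; rewrite mk.
  by move=> [k /= /andP[mk kn] ek]; exists k.
apply: bigcup_measurable => k /andP[mk _]; apply: mPi; exact: leq_trans mk.
Qed.

Lemma stopped_exceed e m n w : (0 < m)%N ->
  (forall n, (0 < n)%N -> restr_partition (Pi n.+1 w) = Pi n w) ->
  exceed e m n w -> e <= stopped e m (Pi n w).
Proof.
move=> m0 rw [k [mk kn ek]].
elim: n kn => [|n IH] kn.
  by have := leq_trans m0 (leq_trans mk kn).
move: kn; rewrite leq_eqVlt => /orP[/eqP kn|]; last first.
  rewrite ltnS => kn; have {}IH := IH kn.
  have mn := leq_trans mk kn.
  by rewrite /= ltnNge mn /= rw ?(leq_trans m0 mn)//= IH.
subst k; rewrite /=; case: ifP => // _.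
by case: ifPn.
Qed.

(** The maximal inequality for nonnegative supermartingales: up to the null set where restriction
    fails to recover the past, the excess event is seen by the stopped process at time n, to which
    Markov's inequality applies. *)
Lemma exceed_le e m n : (0 < m)%N -> 0 < e -> (m <= n)%N ->
  (P (exceed e m n) <= (mean P Pi (@W m) / e)%:E)%E.
Proof.
move=> m0 e0 mn; have n0 : (0 < n)%N by exact: leq_trans mn.
pose U := Pi n @^-1` [set p | e <= stopped e m p].
have mU : measurable U by exact: mPi.
apply: (@le_trans _ _ (P U)).
  have [N [mN N0 sN]] := ae_restr_partition EP alpha_lt1 alpha_theta_gt0.
  apply: (@le_trans _ _ (P (U `|` N))).
    apply: le_measure; rewrite ?inE//; first exact: measurable_exceed.
      exact: measurableU.
    move=> w ew; have [Nw|Nw] := pselect (N w); [by right|left].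
    apply: stopped_exceed => // ; apply: contra_notP Nw => h.
    exact: sN.
  by rewrite measureU0.
have -> : P U = (mean P Pi (fun p : {set {set 'I_n}} =>
  (e <= stopped e m p)%R%:R))%:E.
  rewrite -(expectation_mean EP)// unlock -(setIT U) -integral_indic//.
  by apply: eq_integral => w _; rewrite indicE mem_setE.
rewrite lee_fin ler_pdivlMr// mulrC -meanZ.
apply: le_trans (mean_stopped_le e m0 mn); apply: (mean_le EP) => // p pp.
rewrite mulr_natr; case: (leP e (stopped e m p)) => h /=; first by rewrite ?mulr1n.
by rewrite ?mulr0n stopped_ge0// ltW.
Qed.

Lemma exceed_sup_le e m : (0 < m)%N -> 0 < e ->
  (P (\bigcup_n exceed e m n) <= (mean P Pi (@W m) / e)%:E)%E.
Proof.
move=> m0 e0.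
have nd : nondecreasing_seq (exceed e m).
  by move=> n1 n2 n12; apply/subsetPset => w [k [mk kn ek]]; exists k;
    split=> //; exact: leq_trans n12.
have cv := nondecreasing_cvg_mu (fun n => measurable_exceed e n m0)
  (bigcup_measurable (fun n _ => measurable_exceed e n m0)) nd.
rewrite -(cvg_lim _ (cv _ P))//; apply: lime_le; first by apply/cvg_ex;
  eexists; exact: cv.
by near=> n; apply: exceed_le => //; near: n; exact: nbhs_infty_ge.
Unshelve. all: by end_near. Qed.

Hypothesis W_cvg0 : mean P Pi (@W n) @[n --> \oo] --> 0.

(** The level 1 / (j + 1) is reached after time m with probability at most (j + 1) E W_m, which
    tends to 0 with m; so reaching it at arbitrarily late times is a null event, and countably many
    levels suffice. *)
Lemma ae_cvg0 : {ae P, forall w, W (Pi n w) @[n --> \oo] --> 0}.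
Proof.
pose B j := \bigcap_(m in [set m | (0 < m)%N]) \bigcup_n exceed (j.+1%:R^-1) m n.
have mB j : measurable (B j).
  apply: bigcap_measurable => [|m m0]; first by exists 1%N.
  by apply: bigcup_measurable => n _; exact: measurable_exceed.
have : {ae P, forall w, forall j, ~ B j w}.
  apply/ae_foralln => j; exists (B j); split; last by move=> w /= /contrapT.
    exact: mB.
  apply/eqP; rewrite eq_le measure_ge0 andbT.
  apply/lee_addgt0Pr => e e0; rewrite add0e.
  have e'0 : 0 < e * j.+1%:R^-1 by rewrite mulr_gt0// invr_gt0.
  have /cvgrPdist_le/(_ _ e'0) [m0 _ hm] := W_cvg0.
  pose m := m0.+1.
  apply: (@le_trans _ _ (P (\bigcup_n exceed (j.+1%:R^-1) m n))).
    apply: le_measure; rewrite ?inE.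
    - exact: mB.
    - by apply: bigcup_measurable => n _; exact: measurable_exceed.
    - by move=> w; apply.
  apply: le_trans (exceed_sup_le _ _) _ => //.
  rewrite lee_fin ler_pdivrMr ?invr_gt0//.
  have := hm m (leqnSn m0); rewrite sub0r normrN; apply: le_trans.
  exact: ler_norm.
apply: filterS => w Bw; apply/cvgrPdist_lt => e e0.
have [j je] : exists j, j.+1%:R^-1 < e.
  exists (Num.truncn e^-1).
  by rewrite invf_plt ?posrE// truncnS_gt.
have := Bw j; rewrite -existsNP => -[m /not_implyP[m0 hm]].
exists m => // n /= mn; rewrite sub0r normrN ger0_norm; last first.
  by apply: W_ge0; exact: leq_trans mn.
apply: lt_trans je; rewrite ltNge; apply/negP => le.
by apply: hm; exists n => //; exists n.
Qed.

End Maximal.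

Section AlmostSure.
Context (d : measure_display) (T : measurableType d) (R : realType).
Variables (P : probability T R) (alpha theta : R).
Variable Pi : forall n : nat, T -> {set {set 'I_n}}.
Hypothesis EP : ewens_pitman P alpha theta Pi.
Hypotheses (alpha_gt0 : 0 < alpha) (alpha_lt1 : alpha < 1).
Hypothesis alpha_theta_gt0 : 0 < alpha + theta.

Theorem alpha_hat_cvg : {ae P, forall w, alpha_hat R Pi n w @[n --> \oo] --> alpha}.
Proof.
have c0 := lyap_cst_gt0 alpha_gt0 alpha_theta_gt0.
have W0 n (p : {set {set 'I_n}}) :
  (0 < n)%N -> 0 <= stat alpha (lyap alpha theta) p.
  by move=> _; rewrite addr_ge0 ?sqr_ge0// divr_ge0// ltW.
have Wsuper n (p : {set {set 'I_n}}) : (0 < n)%N -> finset.partition p [set: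
  'I_n]%SET ->
    step alpha theta (@stat R alpha (lyap alpha theta) n.+1) p <= stat alpha
      (lyap alpha theta) p.
  move=> n0 pp; have N0 := ntheta_gt0 alpha_lt1 alpha_theta_gt0 n0.
  rewrite step_stat ?gt_eqF// gerDl pmulr_lle0 ?invr_gt0//.
  apply: le_trans (drift_lyap _ _ _ (admissible_stat alpha n0 pp)) _ => //.
  rewrite mulNr oppr_le0; apply: mulr_ge0; first exact/ltW/lyap_rate_gt0.
  exact: (W0 n).
have Wcvg : mean P Pi (@stat R alpha (lyap alpha theta) n) @[n --> \oo] --> 0.
  pose w n := decay theta (lyap_rate alpha theta / 2) 1 n.
  have r0 := lyap_rate_gt0 alpha_gt0 alpha_theta_gt0.
  have r1 := lyap_rate_lt alpha_gt0 alpha_lt1 alpha_theta_gt0 (ltn0Sn 0).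
  have cw : w n @[n --> \oo] --> 0.
    apply: cvg_decay; first exact: ntheta1 alpha_theta_gt0.
      by rewrite divr_gt0.
    by lra.
  apply: (@squeeze_cvgr _ _ _ _ (fun=> 0) (fun n =>
    (1 + lyap_cst alpha theta) * (w n * w n))).
  - near=> n; have n0 : (0 < n)%N by near: n; exact: nbhs_infty_gt.
    rewrite -expr2 (mean_lyap EP)// andbT -[leLHS](mean_cst EP 0 n0).
    by apply: (mean_le EP) => // p pp; exact: W0.
  - exact: cvg_cst.
  - rewrite -[X in _ --> X](mulr0 (1 + lyap_cst alpha theta)); apply: cvgMr.
    by rewrite -[X in _ --> X](mulr0 0); apply: cvgM.
have := ae_cvg0 EP alpha_lt1 alpha_theta_gt0 W0 Wsuper Wcvg.
apply: filterS => w /cvgrPdist_lt cw; apply/cvgrPdist_lt => e e0.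
(* The level is e^2 because (alpha_hat - alpha)^2 = (D / K)^2 is one of the two nonnegative terms of
   [lyap]. *)
have e20 : 0 < e ^+ 2 by rewrite exprn_gt0.
near=> n; have n0 : (0 < n)%N by near: n; exact: nbhs_infty_gt.
have : `|0 - stat alpha (lyap alpha theta) (Pi n w)| < e ^+ 2.
  by near: n; exact: cw.
rewrite sub0r normrN ger0_norm ?W0// => We.
have K0 : 0 < (nblocks (Pi n w))%:R :> R.
  by rewrite ltr0n nblocks_gt0// (ewens_pitman_partition EP).
rewrite -ltr_sqr ?nnegrE ?normr_ge0 ?(ltW e0)// real_normK ?num_real//;
  apply: le_lt_trans We.
rewrite /stat /lyap /alpha_hat -opprB sqrrN mulrBl mulfK ?gt_eqF// lerDl.
by rewrite divr_ge0// ltW.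
Unshelve. all: by end_near. Qed.

End AlmostSure.

(** * Trigonometric estimates *)

Section Trigonometry.
Variable R : realType.
Implicit Types a x y e : R.

(** Integrates an inequality once. Starting from cos <= 1 and sin <= 1, repeated use produces the
    Taylor bounds below, each from an earlier one. *)
Lemma derive_ge0_ge0 (f df : R -> R) : (forall x, is_derive x 1 f (df x)) ->
  f 0 = 0 -> (forall x, 0 <= x -> 0 <= df x) -> forall x, 0 <= x -> 0 <= f x.
Proof.
move=> fdf f0 df0 x x0.
have [|c] := @MVT_segment R f df 0 x x0 (fun y _ => fdf y).
  by apply/continuous_subspaceT => y;
    apply/differentiable_continuous/derivable1_diffP/ex_derive.
by rewrite in_itv/= => /andP[c0 _]; rewrite f0 !subr0 => ->; rewrite mulr_ge0 ?df0.
Qed.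

Let sin_le x : 0 <= x -> 0 <= x - sin x.
Proof.
apply: (@derive_ge0_ge0 (fun x => x - sin x) (fun x => 1 - cos x)) => //.
by rewrite sin0 subr0.
Qed.

Let cos_ge1 x : 0 <= x -> 0 <= x - (1 - cos x).
Proof.
apply: (@derive_ge0_ge0 (fun x => x - (1 - cos x)) (fun x => 1 - sin x)) => //.
- by move=> y; apply: is_derive_eq; ring.
- by rewrite cos0 !subrr.
Qed.

Let cos_ge2 x : 0 <= x -> 0 <= x ^+ 2 / 2 - (1 - cos x).
Proof.
apply: (@derive_ge0_ge0 (fun x => x ^+ 2 / 2 - (1 - cos x)) (fun x =>
  x - sin x)) => //.
- by move=> y; apply: is_derive_eq; rewrite /GRing.scale/= ; field.
- by rewrite cos0; ring.
Qed.

Let sin_ge2 x : 0 <= x -> 0 <= x ^+ 2 / 2 - (x - sin x).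
Proof.
apply: (@derive_ge0_ge0 (fun x => x ^+ 2 / 2 - (x - sin x)) (fun x =>
  x - (1 - cos x))) => //.
- by move=> y; apply: is_derive_eq; rewrite /GRing.scale/= ; field.
- by rewrite sin0; ring.
Qed.

Let sin_ge3 x : 0 <= x -> 0 <= x ^+ 3 / 6 - (x - sin x).
Proof.
apply: (@derive_ge0_ge0 (fun x => x ^+ 3 / 6 - (x - sin x)) (fun x =>
  x ^+ 2 / 2 - (1 - cos x))) => //.
- by move=> y; apply: is_derive_eq; rewrite /GRing.scale/= ; field.
- by rewrite sin0; ring.
Qed.

Let cos_le3 x : 0 <= x -> 0 <= x ^+ 3 / 6 - (x ^+ 2 / 2 - (1 - cos x)).
Proof.
apply: (@derive_ge0_ge0 (fun x =>
  x ^+ 3 / 6 - (x ^+ 2 / 2 - (1 - cos x))) (fun x =>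
  x ^+ 2 / 2 - (x - sin x))) => //.
- by move=> y; apply: is_derive_eq; rewrite /GRing.scale/= ; field.
- by rewrite cos0; ring.
Qed.

Let sym (P : R -> Prop) : (forall x, 0 <= x -> P x) -> (forall x, P (- x) -> P x) ->
  forall x, P x.
Proof.
move=> h hN x; have [x0|x0] := leP 0 x; first exact: h.
by apply: hN; apply: h; rewrite oppr_ge0 ltW.
Qed.

Lemma sin_taylor2 x : `|sin x - x| <= x ^+ 2 / 2.
Proof.
elim/sym: x => x; last by rewrite sinN sqrrN -opprD normrN.
move=> x0; have := sin_le x0; have := sin_ge2 x0 => h1 h2.
by rewrite ler_norml; apply/andP; split; lra.
Qed.

Lemma sin_taylor3 x : `|sin x - x| <= `|x| ^+ 3 / 6.
Proof.
elim/sym: x => x; last by rewrite sinN normrN -opprD normrN.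
move=> x0; have := sin_le x0; have := sin_ge3 x0 => h1 h2; rewrite (ger0_norm x0).
by rewrite ler_norml; apply/andP; split; lra.
Qed.

Lemma normr_sin_le x : `|sin x| <= `|x|.
Proof.
elim/sym: x => x; last by rewrite sinN !normrN.
move=> x0; rewrite (ger0_norm x0) ler_norml; apply/andP; split; last first.
  by rewrite -subr_ge0 sin_le.
rewrite -subr_ge0 opprK addrC.
apply: (@derive_ge0_ge0 (fun x => x + sin x) (fun x => 1 + cos x)) x0 => //.
  by rewrite sin0 addr0.
Qed.

Lemma cos_taylor2 x : `|cos x - 1| <= x ^+ 2 / 2.
Proof.
elim/sym: x => x; last by rewrite cosN sqrrN.
move=> x0; have := cos_ge2 x0; have := cos_le1 x => h1 h2.
by rewrite ler_norml; apply/andP; split; lra.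
Qed.

Lemma cos_taylor3 x : `|cos x - 1 + x ^+ 2 / 2| <= `|x| ^+ 3 / 6.
Proof.
elim/sym: x => x; last by rewrite cosN sqrrN normrN.
move=> x0; have := cos_ge2 x0; have := cos_le3 x0 => h1 h2; rewrite (ger0_norm x0).
by rewrite ler_norml; apply/andP; split; lra.
Qed.

Lemma cosD_taylor2 a x : `|cos (a + x) - cos a + x * sin a| <= x ^+ 2.
Proof.
rewrite cosD [X in `|X|](_ : _ = cos a * (cos x - 1) - sin a * (sin x - x));
  last by ring.
apply: le_trans (ler_normB _ _) _; rewrite !normrM.
have -> : x ^+ 2 = 1 * (x ^+ 2 / 2) + 1 * (x ^+ 2 / 2) by field.
apply: lerD; apply: ler_pM => //; first exact: cos_max.
- exact: cos_taylor2.
- exact: sin_max.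
- exact: sin_taylor2.
Qed.

Lemma cosD_taylor3 a x :
  `|cos (a + x) - cos a + x * sin a + x ^+ 2 / 2 * cos a| <= `|x| ^+ 3.
Proof.
rewrite cosD [X in `|X|](_ :
  _ = cos a * (cos x - 1 + x ^+ 2 / 2) - sin a * (sin x - x)); last by ring.
apply: le_trans (ler_normB _ _) _; rewrite !normrM.
apply: (@le_trans _ _ (1 * (`|x| ^+ 3 / 6) + 1 * (`|x| ^+ 3 / 6))).
  apply: lerD; apply: ler_pM => //; first exact: cos_max.
  - exact: cos_taylor3.
  - exact: sin_max.
  - exact: sin_taylor3.
by have h : 0 <= `|x| ^+ 3 := exprn_ge0 3 (normr_ge0 x); lra.
Qed.

Lemma expRN_taylor2 x : 0 <= x -> `|expR (- x) - (1 - x)| <= x ^+ 2.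
Proof.
move=> x0; have h1 := expR_ge1Dx (- x); rewrite ger0_norm; last by lra.
have h2 := expR_ge1Dx x.
have h3 : expR (- x) * (1 + x) <= 1.
  by rewrite -[leRHS](expRxMexpNx_1 x) mulrC ler_wpM2r// expR_ge0.
have x2 := sqr_ge0 x; have x3 : 0 <= x * x ^+ 2 by rewrite mulr_ge0.
(* The right-hand side is 1 + x^3, and the left-hand side is at most 1. *)
have : expR (- x) * (1 + x) <= (1 - x + x ^+ 2) * (1 + x) by lra.
by rewrite ler_pM2r; lra.
Qed.

End Trigonometry.

(** * Expected oscillations *)

Section OneStep.
Variable R : realType.

(* With q = sqrt x, q' = sqrt (x + 1) and D = u x, the jump of D / sqrt x when a
   block is opened (a = 1 - alpha). *)
Lemma normalized_jump (q q' u a : R) : 0 < q -> 0 < q' -> q' ^+ 2 = q ^+ 2 + 1 ->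
  `|u| <= 1 -> 0 <= a <= 1 ->
  exists2 e, `|e| <= 2 &
    (u * q ^+ 2 + a) / q' - u * q = q^-1 * (a - u / 2 + e * (q^-1) ^+ 2).
Proof.
move=> q0 q'0 qq' u1 /andP[a0 a1].
have qn : q != 0 by rewrite gt_eqF.
have q'n : q' != 0 by rewrite gt_eqF.
have lqq' : q <= q'.
  by rewrite -ler_sqr ?nnegrE ?(ltW q0) ?(ltW q'0)// qq' lerDl.
have qsn : q + q' != 0 by rewrite gt_eqF// addr_gt0.
(* The remainders in q^2 / q' = q - 1 / (2 q) + B1 and 1 / q' = 1 / q - B2; both turn out to lie
   between 0 and q^-3. *)
pose B1 := q ^+ 2 / q' - q + (2 * q)^-1.
pose B2 := q^-1 - q'^-1.
have B2E : B2 = (q * q' * (q + q'))^-1.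
  rewrite /B2 (_ : _ - _ = (q' ^+ 2 - q ^+ 2) / (q * q' * (q + q'))); last first.
    by field; rewrite ?qn ?q'n ?qsn.
  by rewrite qq' addrAC subrr add0r mul1r.
have B1E : B1 = (q * (q' - q) + 1) / (2 * (q * q' * (q + q'))).
  apply/eqP; rewrite -subr_eq0; apply/eqP.
  rewrite (_ : _ - _ = (q' ^+ 2 - (q ^+ 2 + 1)) * (1 - 2 * q ^+ 2) / (2 * (q *
    q' * (q + q')))); last first.
    by rewrite /B1; field; rewrite ?qn ?q'n ?qsn.
  by rewrite qq' subrr !mul0r.
have q3 : 0 < q ^+ 3 by rewrite exprn_gt0.
have den : q ^+ 3 <= q * q' * (q + q').
  rewrite (_ : q ^+ 3 = q * q * q); last by ring.
  apply: ler_pM; [by rewrite mulr_ge0 ?(ltW q0)|exact: ltW| |by rewrite lerDl ltW].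
  by rewrite ler_wpM2l// ltW.
have den0 : 0 < q * q' * (q + q') by rewrite !mulr_gt0// addr_gt0.
have hB2 : 0 <= B2 * q ^+ 3 <= 1.
  rewrite B2E mulrC divr_ge0 ?(ltW q3) ?(ltW den0)//=.
  by rewrite ler_pdivrMr// mul1r.
have hB1 : 0 <= B1 * q ^+ 3 <= 1.
  have t0 : 0 <= q * (q' - q) by rewrite mulr_ge0 ?subr_ge0// ltW.
  have t1 : q * (q' - q) <= 1.
    have : (q' - q) * (q + q') = 1.
      by rewrite (_ : _ * _ = q' ^+ 2 - q ^+ 2);
        [rewrite qq' addrAC subrr add0r|ring].
    move=> <-; rewrite mulrC ler_wpM2l ?subr_ge0// lerDl ltW//.
  rewrite B1E mulrAC; move: (q * (q' - q)) t0 t1 => z t0 t1.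
  have z0 : 0 <= z + 1 by lra.
  move: (q * q' * (q + q')) den den0 => w den den0.
  apply/andP; split.
    by apply: divr_ge0; apply: mulr_ge0 => //; exact: ltW.
  rewrite ler_pdivrMr ?mulr_gt0// mul1r; apply: ler_pM => //; first exact: ltW.
  by lra.
exists (u * (B1 * q ^+ 3) - a * (B2 * q ^+ 3)); last first.
  by rewrite /B1 /B2; field; rewrite ?qn ?q'n.
apply: le_trans (ler_normB _ _) _; rewrite !normrM (_ : 2 = 1 * 1 + 1 * 1);
  last by ring.
move: hB1 hB2 => /andP[b1 b1'] /andP[b2 b2'].
by apply: lerD; apply: ler_pM;
  rewrite ?(ger0_norm a0) -?normrM ?(ger0_norm b1) ?(ger0_norm b2).
Qed.

Variables (alpha theta : R).
Hypotheses (alpha_gt0 : 0 < alpha) (alpha_lt1 : alpha < 1).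
Hypothesis alpha_theta_gt0 : 0 < alpha + theta.

Definition osc (s phi x D : R) := cos (s * (D / Num.sqrt x) + phi).

(** c = (1 - alpha) + alpha / 2: the restoring drift of D, plus the contraction of X due to the
    growth of sqrt K. *)
Local Notation c := (1 - alpha / 2).
Local Notation v := (alpha * (1 - alpha)).

(** Here r = 1 / sqrt K and u = D / K; X jumps by r k when a block is opened and by - r when a
    singleton is enlarged. At first order the terms alpha (1 - alpha) / r of the two transitions
    cancel, leaving - c u / r; at second order alpha (1 - alpha)^2 + alpha (1 - alpha) = 2 c v. *)
Lemma drift_osc_aux (M s y k u r e : R) : 1 <= M -> `|s| <= M -> 0 < r -> r <= 1 ->
  `|u| <= 1 -> 0 <= alpha + u -> alpha + u <= 1 -> `|e| <= 2 ->
  k = 1 - alpha - u / 2 + e * r ^+ 2 ->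
  `| (alpha / r ^+ 2 + theta) * (cos (y + s * (r * k)) - cos y) +
     (1 - alpha) * (alpha + u) / r ^+ 2 * (cos (y + - (s * r)) - cos y)
     - (s * c * (u / r) * sin y - s ^+ 2 * (c * v) * cos y) |
  <= (80 + 84 * `|theta|) * M ^+ 3 * (r + `|u|).
Proof.
have [a0 a1] := (alpha_gt0, alpha_lt1).
move=> M1 sM r0 r1 u1 au0 au1 e2 kE.
have rn : r != 0 by rewrite gt_eqF.
have M0 : 0 <= M by lra.
have r00 := ltW r0.
have t0 := normr_ge0 theta.
have ru : 0 <= r + `|u| by rewrite addr_ge0.
have r2 : r ^+ 2 <= 1 by rewrite expr_le1.
have r2r : r ^+ 2 <= r by rewrite expr2 ger_pMr.
have er : `|e * r ^+ 2| <= 2 * r ^+ 2.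
  by rewrite normrM (ger0_norm (sqr_ge0 r)) ler_wpM2r// sqr_ge0.
have k4 : `|k| <= 4.
  have : `|e * r ^+ 2| <= 2 by apply: le_trans er _; lra.
  rewrite kE; move: u1; rewrite !ler_norml => /andP[? ?] /andP[? ?].
  by apply/andP; split; lra.
(* [E] is the Taylor remainder, cubic in the jump, so that the rates of order r^-2 leave an error of
   order r. [e1] and [e2'] are what the first and second order terms leave beyond the
   Ornstein-Uhlenbeck generator. *)
pose E d := cos (y + d) - cos y + d * sin y + d ^+ 2 / 2 * cos y.
have E3 d : `|E d| <= `|d| ^+ 3 by exact: cosD_taylor3.
pose e1 := alpha * e * r + theta * k * r.
pose e2' := alpha * (k ^+ 2 - (1 - alpha) ^+ 2) + theta * r ^+ 2 * k ^+ 2 + (1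
  - alpha) * u.
rewrite [X in `|X|](_ : _ = (alpha / r ^+ 2 + theta) * E (s * (r * k)) +
   (1 - alpha) * (alpha + u) / r ^+ 2 * E (- (s * r))
   - s * e1 * sin y - s ^+ 2 / 2 * e2' * cos y); last first.
  by rewrite /E /e1 /e2' kE; field.
have h1 : `|(alpha / r ^+ 2 + theta) * E (s * (r * k))| <= (64 + 64 * `|theta|)
  * M ^+ 3 * r.
  have -> : (64 + 64 * `|theta|) * M ^+ 3 * r = ((1 + `|theta|) / r ^+ 2) * (M
    * (r * 4)) ^+ 3.
    by field.
  rewrite normrM; apply: ler_pM => //.
    apply: le_trans (ler_normD _ _) _; rewrite mulrDl; apply: lerD.
      rewrite ger0_norm ?divr_ge0 ?sqr_ge0 ?(ltW a0)//.
      by rewrite ler_wpM2r ?invr_ge0 ?sqr_ge0// ltW.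
    by rewrite ler_pdivlMr ?exprn_gt0// ler_piMr.
  apply: le_trans (E3 _) _; rewrite ler_pXn2r ?nnegrE ?mulr_ge0//.
  rewrite !normrM (ger0_norm r00); apply: ler_pM => //; first by rewrite mulr_ge0.
  by rewrite ler_wpM2l.
have h2 : `|(1 - alpha) * (alpha + u) / r ^+ 2 * E (- (s * r))| <= M ^+ 3 * r.
  have -> : M ^+ 3 * r = (1 / r ^+ 2) * (M * r) ^+ 3 by field.
  rewrite normrM; apply: ler_pM => //.
    rewrite ger0_norm ?divr_ge0 ?sqr_ge0 ?mulr_ge0//; last by lra.
    rewrite ler_wpM2r ?invr_ge0 ?sqr_ge0// mulr_ile1//; lra.
  apply: le_trans (E3 _) _; rewrite ler_pXn2r ?nnegrE ?mulr_ge0//.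
  by rewrite normrN normrM (ger0_norm r00) ler_wpM2r.
have M13 : 1 <= M ^+ 2 by rewrite exprn_ege1.
have MM : M <= M ^+ 3 by rewrite exprS ler_peMr.
have M23 : M ^+ 2 <= M ^+ 3 by rewrite [leRHS]exprS ler_peMl// sqr_ge0.
have h3 : `|s * e1 * sin y| <= (2 + 4 * `|theta|) * M ^+ 3 * r.
  have -> : (2 + 4 * `|theta|) * M ^+ 3 * r = M ^+ 3 * ((2 + 4 * `|theta|) * r)
    * 1 by ring.
  rewrite !normrM; apply: ler_pM => //; rewrite ?sin_max ?mulr_ge0//.
  apply: ler_pM => //; first exact: le_trans MM.
  rewrite /e1 -mulrDl normrM (ger0_norm r00) ler_wpM2r//.
  apply: le_trans (ler_normD _ _) _; rewrite !normrM; apply: lerD.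
    rewrite -[leRHS]mul1r; apply: ler_pM => //.
    by rewrite ger0_norm ltW.
  by rewrite mulrC ler_wpM2r.
have h4 : `|s ^+ 2 / 2 * e2' * cos y| <= M ^+ 3 * (4 * `|u| + (10 + 16 *
  `|theta|) * r).
  have B0 : 0 <= 4 * `|u| + (10 + 16 * `|theta|) * r.
    by rewrite addr_ge0 ?mulr_ge0// addr_ge0// mulr_ge0.
  rewrite -[leRHS]mulr1 !normrM; apply: ler_pM => //; rewrite ?cos_max ?mulr_ge0//.
  apply: ler_pM => //.
    apply: le_trans M23; rewrite -expr2 normfV (ger0_norm (ler0n _ 2)).
    apply: (@le_trans _ _ (`|s| ^+ 2)); first by rewrite ler_piMr ?sqr_ge0//; lra.
    by rewrite ler_pXn2r ?nnegrE.
  rewrite /e2'; apply: le_trans (ler_normD _ _) _.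
  rewrite (_ : 4 * `|u| + _ = (3 * `|u| + 10 * r + 16 * `|theta| * r) + `|u|);
    last by ring.
  apply: lerD; last first.
    by rewrite normrM ler_piMl// ger0_norm; lra.
  apply: le_trans (ler_normD _ _) _; apply: lerD; last first.
    rewrite !normrM (_ : 16 * `|theta| * r = `|theta| * r * 16); last by ring.
    apply: ler_pM; rewrite ?mulr_ge0//.
      by apply: ler_pM => //; rewrite ger0_norm// sqr_ge0.
    by rewrite (_ : 16 = 4 * 4) ?ler_pM//; ring.
  rewrite normrM ger0_norm ?(ltW a0)//.
  apply: (@le_trans _ _ (`|k ^+ 2 - (1 - alpha) ^+ 2|));
    first by rewrite ler_piMl// ltW.
  rewrite subr_sqr normrM.
  have hk1 : `|k - (1 - alpha)| <= `|u| / 2 + 2 * r.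
    have -> : k - (1 - alpha) = - (u / 2) + e * r ^+ 2 by rewrite kE; ring.
    apply: le_trans (ler_normD _ _) _; apply: lerD.
      by rewrite normrN normrM normfV (ger0_norm (ler0n _ 2)).
    by apply: le_trans er _; lra.
  have hk2 : `|k + (1 - alpha)| <= 5.
    by move: k4; rewrite !ler_norml => /andP[? ?]; apply/andP; split; lra.
  apply: (@le_trans _ _ ((`|u| / 2 + 2 * r) * 5)); first by apply: ler_pM.
  have := normr_ge0 u; lra.
apply: le_trans (ler_normB _ _) _; apply: le_trans (lerD (ler_normB _ _) h4) _.
apply: le_trans (lerD (lerD (ler_normD _ _) h3) (lexx _)) _.
apply: le_trans (lerD (lerD (lerD h1 h2) (lexx _)) (lexx _)) _.
have -> : (64 + 64 * `|theta|) * M ^+ 3 * r + M ^+ 3 * r + (2 + 4 * `|theta|) *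
  M ^+ 3 * r +
    M ^+ 3 * (4 * `|u| + (10 + 16 * `|theta|) * r) =
  M ^+ 3 * ((77 + 84 * `|theta|) * r + 4 * `|u|) by ring.
rewrite [leRHS](_ : _ = M ^+ 3 * ((80 + 84 * `|theta|) * (r + `|u|))); last by ring.
rewrite ler_wpM2l ?exprn_ge0//.
have : 0 <= `|theta| * `|u| by rewrite mulr_ge0.
by have := normr_ge0 u; lra.
Qed.

Lemma drift_osc n (M s phi x D : R) :
  1 <= M -> `|s| <= M -> admissible alpha n x D ->
  `| drift alpha theta (osc s phi) x D -
     (s * c * (D / Num.sqrt x) * sin (s * (D / Num.sqrt x) + phi)
      - s ^+ 2 * (c * v) * osc s phi x D) |
  <= (80 + 84 * `|theta|) * M ^+ 3 * ((Num.sqrt x)^-1 + `|D / x|).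
Proof.
have [a0 a1] := (alpha_gt0, alpha_lt1).
move=> M1 sM [x1 _ D0 Dx]; have x0 : 0 < x by lra.
have [u Du] : exists u, D = u * x by exists (D / x); rewrite divfK ?gt_eqF.
have u0 : 0 <= alpha + u by rewrite Du -mulrDl pmulr_lge0 in D0.
have u1 : alpha + u <= 1 by rewrite Du -mulrDl ger_pMl in Dx.
have uu : `|u| <= 1 by rewrite ler_norml; lra.
pose q := Num.sqrt x; pose q' := Num.sqrt (x + 1).
have q0 : 0 < q by rewrite sqrtr_gt0.
have q'0 : 0 < q' by rewrite sqrtr_gt0; lra.
have qx : q ^+ 2 = x by rewrite sqr_sqrtr// ltW.
have q'x : q' ^+ 2 = x + 1 by rewrite sqr_sqrtr//; lra.
have q1 : 1 <= q by rewrite -ler_sqr ?nnegrE ?(ltW q0)// qx expr1n.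
have qn : q != 0 by rewrite gt_eqF.
have a01 : 0 <= 1 - alpha <= 1 by lra.
have [|e e2 eE] := normalized_jump q0 q'0 _ uu a01; first by rewrite q'x qx.
have XE : D / Num.sqrt x = u / q^-1.
  by rewrite Du -/q -qx invrK; field.
rewrite XE.
have DxE : D / x = u by rewrite Du mulfK// gt_eqF.
rewrite DxE -/q.
have := drift_osc_aux (s * (u / q^-1) + phi) M1 sM _ _ uu u0 u1 e2 erefl.
move=> /(_ q^-1); rewrite invr_gt0 invf_le1// => /(_ q0 q1).
congr (`| _ - (_ - _ * _) | <= _); last by rewrite /osc XE.
rewrite /drift /osc XE -/q' -eE; congr (_ * (cos _ - _) + _ * (cos _ - _)).
- by rewrite -qx; field.
- by rewrite Du -qx invrK; ring.
- by rewrite Du -qx; field.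
- by rewrite Du -/q -qx; field.
Qed.

End OneStep.

(* The generator c (v g'' - X g') of the Ornstein-Uhlenbeck process applied to
   g = cos (s X + phi) is s c X sin y - s^2 c v cos y. *)
Lemma mehler_step (R : realType) (c v M s X phi t r y : R) :
  0 <= c <= 1 -> 0 <= v <= 1 -> 1 <= M -> `|s| <= M -> 0 <= t <= 1 ->
  r = 1 - c * t -> y = s * X + phi ->
  `|expR (- (s ^+ 2 * v * (1 - r ^+ 2) / 2)) * cos (s * r * X + phi) -
    (cos y + (s * c * X * sin y - s ^+ 2 * (c * v) * cos y) * t)|
  <= 3 * M ^+ 4 * (1 + X ^+ 2) * t ^+ 2.
Proof.
move=> /andP[c0 c1] /andP[v0 v1] M1 sM /andP[t0 t1] rE yE.
have M0 : 0 <= M by lra.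
(* [eta] is the damping exponent, s^2 c v t up to order t^2, and [dl] is the phase change s (r - 1)
   X. The product of the damping and the shifted cosine is expanded to first order in t; the four
   remainders are each of order t^2. *)
pose eta := s ^+ 2 * v * (1 - r ^+ 2) / 2; pose dl := - (s * c * X * t).
have s2 : s ^+ 2 <= M ^+ 2
  by rewrite -[leLHS]real_normK ?num_real// ler_pXn2r ?nnegrE.
have s20 := sqr_ge0 s.
have ct1 : c * t <= 1 by rewrite mulr_ile1.
have ct0 : 0 <= c * t by rewrite mulr_ge0.
have etaE : eta = s ^+ 2 * v * (c * t) * (1 - c * t / 2) by rewrite /eta rE; field.
have h5 : 0 <= 1 - c * t / 2 by move: ct1 ct0; move: (c * t) => z; lra.
have h6 : 1 - c * t / 2 <= 1 by move: ct1 ct0; move: (c * t) => z; lra.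
have eta0 : 0 <= eta by rewrite etaE mulr_ge0// mulr_ge0// mulr_ge0.
have svM : s ^+ 2 * v <= M ^+ 2 by rewrite -[leRHS]mulr1; apply: ler_pM.
have ctt : c * t <= t by rewrite ler_piMl.
have sv0 : 0 <= s ^+ 2 * v by rewrite mulr_ge0.
have etaM : eta <= M ^+ 2 * t.
  rewrite etaE -[leRHS]mulr1; apply: ler_pM => //; first exact: mulr_ge0.
  exact: ler_pM.
have E2 := expRN_taylor2 eta0; have E1 := cosD_taylor2 y dl.
have dlM : `|dl| <= M * `|X| * t.
  rewrite normrN !normrM (ger0_norm t0) (ger0_norm c0) ler_wpM2r// ler_wpM2r//.
  by rewrite -[leRHS]mulr1; apply: ler_pM.
have eE1 : expR (- eta) <= 1 by rewrite expR_le1 oppr_le0.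
have eE0 := expR_ge0 (- eta).
have eEg := expR_ge1Dx (- eta).
rewrite -/eta (_ : s * r * X + phi = y + dl); last by rewrite /dl yE rE; ring.
rewrite [X in `|X|](_ : _ = expR (- eta) * (cos (y + dl) - cos y + dl * sin y) +
   (expR (- eta) - 1) * (- dl * sin y) + (expR (- eta) - (1 - eta)) * cos y +
   s ^+ 2 * v * (c * t) ^+ 2 / 2 * cos y); last first.
  by rewrite {5}etaE /dl; field.
have t20 := sqr_ge0 t.
have dl2 : dl ^+ 2 <= M ^+ 2 * X ^+ 2 * t ^+ 2.
  rewrite -!exprMn -[leLHS]real_normK ?num_real// -[leRHS]real_normK ?num_real//.
  by rewrite ler_pXn2r ?nnegrE// !normrM (ger0_norm t0) (ger0_norm M0).
have h1 : `|expR (- eta) * (cos (y + dl) - cos y + dl * sin y)| <= M ^+ 2 * X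
  ^+ 2 * t ^+ 2.
  rewrite normrM (ger0_norm eE0) -[leRHS]mul1r; apply: ler_pM => //.
  exact: le_trans E1 _.
have h2 : `|(expR (- eta) - 1) * (- dl * sin y)| <= (M ^+ 2 * t) * (M * `|X| * t).
  rewrite normrM; apply: ler_pM => //.
    by apply: le_trans etaM; rewrite ler_norml; lra.
  by rewrite normrM normrN -[leRHS]mulr1; apply: ler_pM => //; exact: sin_max.
have h3 : `|(expR (- eta) - (1 - eta)) * cos y| <= (M ^+ 2 * t) ^+ 2.
  rewrite normrM -[leRHS]mulr1; apply: ler_pM => //; last exact: cos_max.
  by apply: le_trans E2 _; rewrite ler_pXn2r ?nnegrE// mulr_ge0// sqr_ge0.
have h4 : `|s ^+ 2 * v * (c * t) ^+ 2 / 2 * cos y| <= M ^+ 2 * t ^+ 2.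
  rewrite normrM -[leRHS]mulr1; apply: ler_pM => //; last exact: cos_max.
  have sct0 : 0 <= s ^+ 2 * v * (c * t) ^+ 2 by rewrite mulr_ge0// sqr_ge0.
  rewrite ger0_norm ?divr_ge0//.
  apply: (@le_trans _ _ (s ^+ 2 * v * (c * t) ^+ 2)).
    by rewrite ler_piMr//; lra.
  by apply: ler_pM => //; rewrite ?sqr_ge0// ler_pXn2r ?nnegrE.
have XX : `|X| <= (1 + X ^+ 2) / 2.
  rewrite -(real_normK (num_real X)) -subr_ge0.
  by rewrite (_ : _ - _ = (`|X| - 1) ^+ 2 / 2); [rewrite divr_ge0 ?sqr_ge0|field].
have M13 : 1 <= M ^+ 2 by rewrite exprn_ege1.
have M24 : M ^+ 2 <= M ^+ 4
  by rewrite (_ : M ^+ 4 = M ^+ 2 * M ^+ 2) ?ler_peMr ?sqr_ge0//; ring.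
have M34 : M ^+ 3 <= M ^+ 4 by rewrite [leRHS]exprS ler_peMl ?exprn_ge0.
apply: le_trans (ler_normD _ _) _; apply: le_trans (lerD (ler_normD _ _) h4) _.
apply: le_trans (lerD (lerD (ler_normD _ _) h3) (lexx _)) _.
apply: le_trans (lerD (lerD (lerD h1 h2) (lexx _)) (lexx _)) _.
rewrite [leLHS](_ : _ = (M ^+ 2 * X ^+ 2 + M ^+ 3 * `|X| + M ^+ 4 + M ^+ 2) * t
  ^+ 2); last by ring.
rewrite ler_wpM2r//.
have X20 := sqr_ge0 X.
have M40 : 0 <= M ^+ 4 by rewrite exprn_ge0.
have g1 : M ^+ 2 * X ^+ 2 <= M ^+ 4 * X ^+ 2 by rewrite ler_wpM2r.
have g2 : M ^+ 3 * `|X| <= M ^+ 4 * ((1 + X ^+ 2) / 2) by apply: ler_pM;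
  rewrite ?exprn_ge0.
have g3 : 0 <= M ^+ 4 * X ^+ 2 by rewrite mulr_ge0.
lra.
Qed.

(** * Comparison of the chain with the Ornstein-Uhlenbeck semigroup *)

Section Oscillation.
Context (d : measure_display) (T : measurableType d) (R : realType).
Variables (P : probability T R) (alpha theta : R).
Variable Pi : forall n : nat, T -> {set {set 'I_n}}.
Hypothesis EP : ewens_pitman P alpha theta Pi.
Hypotheses (alpha_gt0 : 0 < alpha) (alpha_lt1 : alpha < 1).
Hypothesis alpha_theta_gt0 : 0 < alpha + theta.

Local Notation eta := (lyap_rate alpha theta).
Local Notation lyapf := (lyap alpha theta).
Local Notation w := (decay theta (eta / 2) 1).
Local Notation mean := (mean P Pi).
Local Notation stat := (@stat R alpha).
Local Notation c := (1 - alpha / 2).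
Local Notation v := (alpha * (1 - alpha)).
Local Notation damp s r := (expR (- (s ^+ 2 * v * (1 - r ^+ 2) / 2))).

(** 80 + 84 |theta| comes from [drift_osc] and 6 from [mehler_step]: with N = n + theta, 3 (1 + X^2)
    / N^2 is 6 / N times (1 + X^2) / (2 N), and x <= 2 N bounds the last quotient by 1 / sqrt x + |D
    / x|. *)
Let K2 := 86 + 84 * `|theta|.

Let K2_ge0 : 0 <= K2. Proof. by rewrite addr_ge0// mulr_ge0. Qed.

Lemma osc_step n (M s phi x D : R) : (1 < n)%N -> 1 <= M -> `|s| <= M ->
  admissible alpha n x D ->
  forall r, r = 1 - c / (n%:R + theta) ->
  `|osc s phi x D + drift alpha theta (osc s phi) x D / (n%:R + theta)
    - damp s r * osc (s * r) phi x D| <=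
  K2 * M ^+ 4 / (n%:R + theta) * ((Num.sqrt x)^-1 + `|D / x|).
Proof.
have [a0 a1] := (alpha_gt0, alpha_lt1).
move=> n1 M1 sM adm r rE; have [x1 xn D0 Dx] := adm.
have M0 : 0 <= M by exact: le_trans ler01 M1.
(* Together with theta > -1, n >= 2 gives n + theta >= 1 and n <= 2 (n + theta). *)
have n2 : 2 <= n%:R :> R by rewrite ler_nat.
have atp := alpha_theta_gt0.
have N1 : 1 <= n%:R + theta by lra.
have Nx : x <= 2 * (n%:R + theta) by lra.
have {n2} : 0 < n%:R + theta by lra.
move: (n%:R + theta) N1 Nx rE => N N1 Nx rE N0.
have x0 : 0 < x by lra.
have u1 : `|D / x| <= 1.
  rewrite normrM normfV (gtr0_norm x0) ler_pdivrMr// mul1r ler_norml.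
  have ax1 : alpha * x <= x by rewrite ger_pMl// ltW.
  have ax0 : 0 <= alpha * x by rewrite mulr_ge0 ?ltW.
  by apply/andP; split; lra.
have Nn : N != 0 by rewrite gt_eqF.
have xn0 : x != 0 by rewrite gt_eqF.
pose q := Num.sqrt x.
have q0 : 0 < q by rewrite sqrtr_gt0.
have qx : q ^+ 2 = x by rewrite sqr_sqrtr// ltW.
have qn0 : q != 0 by rewrite gt_eqF.
have q1 : 1 <= q by rewrite -ler_sqr ?nnegrE ?(ltW q0)// qx expr1n.
have c01 : 0 <= c <= 1 by lra.
have v01 : 0 <= v <= 1.
  by rewrite mulr_ge0 ?mulr_ile1 ?subr_ge0 ?(ltW a0) ?(ltW a1)//= gerBl ltW.
have K80 : 0 <= 80 + 84 * `|theta| by rewrite addr_ge0// mulr_ge0.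
have t01 : 0 <= N^-1 <= 1 by rewrite invr_ge0 (ltW N0) invf_le1.
have h1 := mehler_step c01 v01 M1 sM t01 rE (erefl (s * (D / q) + phi)).
have h2 := drift_osc theta alpha_gt0 alpha_lt1 phi M1 sM adm.
rewrite -/q in h2.
rewrite -[X in `|X|](subrK (damp s r * osc (s * r) phi x D)).
set tgt := s * c * (D / q) * sin (s * (D / q) + phi)
      - s ^+ 2 * (c * v) * osc s phi x D in h2.
have -> : osc s phi x D + drift alpha theta (osc s phi) x D / N -
   damp s r * osc (s * r) phi x D - damp s r * osc (s * r) phi x D +
   damp s r * osc (s * r) phi x D =
   (drift alpha theta (osc s phi) x D - tgt) / N -
   (damp s r * osc (s * r) phi x D - (osc s phi x D + tgt / N)) by field.
apply: le_trans (ler_normB _ _) _.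
have g1 : `|(drift alpha theta (osc s phi) x D - tgt) / N| <=
    (80 + 84 * `|theta|) * M ^+ 4 / N * (q^-1 + `|D / x|).
  rewrite normrM (ger0_norm (x := N^-1)) ?invr_ge0 ?(ltW N0)//.
  rewrite mulrAC ler_wpM2r ?invr_ge0 ?(ltW N0)//.
  apply: le_trans h2 _; rewrite ler_wpM2r ?addr_ge0 ?invr_ge0 ?(ltW q0)//.
  rewrite ler_wpM2l//.
  by rewrite [leRHS]exprS ler_peMl// exprn_ge0.
have g2 : `|damp s r * osc (s * r) phi x D - (osc s phi x D + tgt / N)| <=
    6 * M ^+ 4 / N * (q^-1 + `|D / x|).
  apply: le_trans h1 _.
  rewrite (_ : 3 * M ^+ 4 * _ * _ = 6 * M ^+ 4 / N * ((1 + (D / q) ^+ 2) / (2 *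
    N))); last by field; rewrite ?qn0 ?Nn.
  rewrite ler_wpM2l ?divr_ge0 ?mulr_ge0 ?exprn_ge0 ?(ltW N0)//.
  rewrite mulrDl; apply: lerD.
    rewrite mul1r lef_pV2 ?posrE ?mulr_gt0//.
    by apply: le_trans Nx; rewrite -qx expr2 ler_peMl// ltW.
  have -> : (D / q) ^+ 2 / (2 * N) = `|D / x| ^+ 2 * (x / (2 * N)).
    by rewrite real_normK ?num_real// -qx; field; rewrite ?qn0 ?Nn.
  rewrite -[leRHS]mulr1; apply: ler_pM;
    rewrite ?sqr_ge0// ?divr_ge0 ?(ltW x0) ?mulr_ge0 ?(ltW N0)//.
    by rewrite expr2 ler_piMl.
  by rewrite ler_pdivrMr ?mulr_gt0// mul1r.
apply: le_trans (lerD g1 g2) _.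
rewrite (_ : _ + _ = K2 * M ^+ 4 / N * (q^-1 + `|D / x|))//.
by rewrite /K2; ring.
Qed.

(** 1 / sqrt K + |D / K| is at most w + W / w, whose mean is at most (2 + [lyap_cst]) w because E W
    <= (1 + [lyap_cst]) w^2. *)
Let K3 := K2 * (2 + lyap_cst alpha theta).

Let w_gt0 n : 0 < w n.
Proof.
have N1 := ntheta1 alpha_lt1 alpha_theta_gt0; apply: decay_gt0 => //.
have := lyap_rate_lt alpha_gt0 alpha_lt1 alpha_theta_gt0 (ltn0Sn 0).
by have := lyap_rate_gt0 alpha_gt0 alpha_theta_gt0; lra.
Qed.

Lemma mean_osc_step n (M s phi : R) : (1 < n)%N -> 1 <= M -> `|s| <= M ->
  forall r, r = 1 - c / (n%:R + theta) ->
  `|mean (@stat (osc s phi) n.+1) - damp s r * mean (@stat (osc (s * r) phi) n)|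
  <= K3 * M ^+ 4 * w n / (n%:R + theta).
Proof.
move=> n1 M1 sM r rE; have n0 : (0 < n)%N by exact: ltn_trans n1.
have N0 := ntheta_gt0 alpha_lt1 alpha_theta_gt0 n0.
have M0 : 0 <= M by exact: le_trans ler01 M1.
have lc1 : 1 <= lyap_cst alpha theta.
  rewrite /lyap_cst ler_pdivlMr; last by rewrite lt_min alpha_gt0.
  rewrite mul1r ge_min; apply/orP; left; apply: le_trans (ltW alpha_lt1) _.
  by have := normr_ge0 theta; lra.
rewrite (mean_stat_step EP)// [_ / (n%:R + theta)]mulrC -!meanZ -meanD -meanB.
apply: le_trans (mean_norm _ _ _) _.
apply: (@le_trans _ _ (mean (fun p : {set {set 'I_n}} =>
  K2 * M ^+ 4 / (n%:R + theta) *
    (w n + (w n)^-1 * stat lyapf p)))); last first.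
  rewrite meanZ meanD (mean_cst EP)// meanZ.
  rewrite (_ : K3 * _ * _ / _ = K2 * M ^+ 4 / (n%:R + theta) * ((2 + lyap_cst
    alpha theta) * w n)); last first.
    by rewrite /K3; ring.
  rewrite ler_wpM2l ?divr_ge0 ?mulr_ge0 ?exprn_ge0 ?(ltW N0)//.
  rewrite (_ : (2 + _) * w n = w n + (w n)^-1 * ((1 + lyap_cst alpha theta) * w
    n ^+ 2)); last first.
    by have wn := lt0r_neq0 (w_gt0 n); field.
  by rewrite lerD2l ler_wpM2l ?invr_ge0 ?(ltW (w_gt0 n))//; exact: mean_lyap.
apply: (mean_le EP) => // p pp; have adm := admissible_stat alpha n0 pp.
have [x1 _ _ _] := adm; rewrite /stat; set x := (nblocks p)%:R in adm x1 *.
set D := _ - _ in adm *.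
have := osc_step phi n1 M1 sM adm rE.
rewrite [_ / (n%:R + theta) in X in X -> _]mulrC => h; apply: le_trans h _.
rewrite ler_wpM2l ?divr_ge0 ?mulr_ge0 ?exprn_ge0 ?(ltW N0)//.
(* AM-GM: a <= w / 2 + a^2 / (2 w) *)
have amgm (a : R) : 0 <= a -> a <= w n / 2 + (w n)^-1 * a ^+ 2 / 2.
  move=> a0; rewrite -subr_ge0.
  have wn := lt0r_neq0 (w_gt0 n).
  rewrite (_ : _ - _ = (w n)^-1 * (w n - a) ^+ 2 / 2); last by field.
  by rewrite divr_ge0// mulr_ge0 ?sqr_ge0// invr_ge0 ltW.
have x0 : 0 < x by exact: lt_le_trans x1.
have q0 : 0 <= (Num.sqrt x)^-1 by rewrite invr_ge0 sqrtr_ge0.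
apply: le_trans (lerD (amgm _ q0) (amgm _ (normr_ge0 (D / x)))) _.
rewrite real_normK ?num_real// exprVn sqr_sqrtr ?(ltW x0)//.
rewrite (_ : w n / 2 + _ + _ = w n + (w n)^-1 * (((D / x) ^+ 2 + x^-1) / 2));
  last by field; rewrite ?gt_eqF.
rewrite lerD2l ler_wpM2l ?invr_ge0 ?(ltW (w_gt0 n))// /lyap.
have D2 := sqr_ge0 (D / x).
have x0' : 0 < x^-1 by rewrite invr_gt0.
have : x^-1 <= lyap_cst alpha theta / x by rewrite ler_peMl// ltW.
by lra.
Qed.

(** The one-step errors telescope: w_n / (n + theta) = (2 / eta) (w_n - w_{n+1}). *)
Let K4 := K3 * (2 / eta).

Let c_lt m : (1 < m)%N -> c < m%:R + theta.
Proof.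
move=> m1; have : 2 <= m%:R :> R by rewrite ler_nat.
by move: alpha_theta_gt0 alpha_gt0 alpha_lt1; lra.
Qed.

(** The last step is removed first, replacing s by s r. Damping factors compose, since (1 - r^2) +
    r^2 (1 - B^2) = 1 - (r B)^2, and are at most 1, so errors are not amplified; frequencies only
    shrink, so one M serves all steps. *)
Lemma mean_osc_iter m k (M s phi : R) : (1 < m)%N -> 1 <= M -> `|s| <= M ->
  forall A, A = decay theta c m (m + k) ->
  `|mean (@stat (osc s phi) (m + k)) - damp s A * mean (@stat (osc (s * A) phi) m)|
  <= K4 * M ^+ 4 * (w m - w (m + k)).
Proof.
move=> m1 M1; elim: k s => [|k IH] s sM A AE0.
  rewrite AE0 addn0 /decay big_geq// expr1n subrr mulr0 mul0r oppr0 expR0 mul1r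
    mulr1.
  by rewrite !subrr normr0 mulr0.
have M0 : 0 <= M by exact: le_trans ler01 M1.
have mk1 : (1 < m + k)%N by rewrite (leq_trans m1)// leq_addr.
have mk0 : (0 < m + k)%N by exact: ltn_trans mk1.
have N0 := ntheta_gt0 alpha_lt1 alpha_theta_gt0 mk0.
have Nn0 := lt0r_neq0 N0.
pose r := 1 - c / ((m + k)%:R + theta).
have r01 : 0 <= r <= 1.
  have := c_lt mk1; have c0 : 0 <= c by move: alpha_lt1; lra.
  move=> cN; rewrite /r subr_ge0 ler_pdivrMr// mul1r (ltW cN)/=.
  by rewrite gerBl divr_ge0// ltW.
have srM : `|s * r| <= M.
  by rewrite normrM; apply: le_trans sM; rewrite ler_piMr// ger0_norm;
    case/andP: r01.
have AE : A = decay theta c m (m + k) * r.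
  by rewrite AE0 addnS decay_recr ?leq_addr.
have h1 := mean_osc_step phi mk1 M1 sM (erefl r).
have h2 := IH (s * r) srM _ erefl.
rewrite addnS.
set B := decay theta c m (m + k) in AE h2.
set m1' := mean (@stat _ (m + k).+1) in h1 *.
set m2 := mean (@stat _ (m + k)) in h1 h2.
set m3 := mean (@stat _ m) in h2 *.
have dA : damp s A = damp s r * damp (s * r) B.
  by rewrite -expRD AE; congr expR; field.
have -> : mean (stat (osc (s * A) phi) (n:=m)) = m3.
  by rewrite /m3 AE [B * r]mulrC mulrA.
rewrite dA (_ : _ - _ = (m1' - damp s r * m2) + damp s r * (m2 - damp (s * r) B
  * m3)); last by ring.
apply: le_trans (ler_normD _ _) _.
have -> : K4 * M ^+ 4 * (w m - w (m + k).+1) = K3 * M ^+ 4 * w (m + k) / ((m +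
  k)%:R + theta)
   + K4 * M ^+ 4 * (w m - w (m + k)).
  rewrite decay_recr ?(ltnW mk1)// /K4.
  have en := lt0r_neq0 (lyap_rate_gt0 alpha_gt0 alpha_theta_gt0).
  move: ((m + k)%:R + theta) eta Nn0 en => N x Nn0 en.
  by field; rewrite ?en ?Nn0.
apply: lerD => //; rewrite normrM ger0_norm ?expR_ge0//.
apply: le_trans h2; rewrite ler_piMl// expR_le1 oppr_le0 divr_ge0//.
have [r0 r1] := andP r01.
have a1 := ltW alpha_lt1; have a0 := ltW alpha_gt0.
have r2 : r ^+ 2 <= 1 by rewrite expr_le1.
apply: mulr_ge0; last by rewrite subr_ge0.
by rewrite mulr_ge0 ?sqr_ge0// mulr_ge0// subr_ge0.
Qed.

(** First m is fixed so that the comparison error is small for all n >= m at once; then the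
    remaining factor A tends to 0 with n. The comparison value [G A] is a finite sum, continuous at
    0, where it is the Gaussian value whatever the law at time m. *)
Lemma cvg_mean_osc (s phi : R) :
  mean (@stat (osc s phi) n) @[n --> \oo] --> expR (- (s ^+ 2 * v / 2)) * cos phi.
Proof.
pose M := 1 + `|s|.
have M1 : 1 <= M by rewrite lerDl.
have sM : `|s| <= M by rewrite lerDr.
have eta0 := lyap_rate_gt0 alpha_gt0 alpha_theta_gt0.
have N1 := ntheta1 alpha_lt1 alpha_theta_gt0.
have eta1 := lyap_rate_lt alpha_gt0 alpha_lt1 alpha_theta_gt0 (ltn0Sn 0).
have K40 : 0 <= K4 * M ^+ 4.
  have := lyap_cst_gt0 alpha_gt0 alpha_theta_gt0 => lc.
  have lc2 : 0 <= 2 + lyap_cst alpha theta by rewrite addr_ge0// ltW.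
  have M0 := le_trans ler01 M1.
  have e2 : 0 <= 2 / eta by rewrite divr_ge0// ltW.
  exact: mulr_ge0 (mulr_ge0 (mulr_ge0 K2_ge0 lc2) e2) (exprn_ge0 4 M0).
apply/cvgrPdist_le => e e0.
have e20 : 0 < e / 2 by rewrite divr_gt0.
have cw : w n @[n --> \oo] --> 0.
  by apply: cvg_decay => //; [rewrite divr_gt0|lra].
have {cw} : K4 * M ^+ 4 * w n @[n --> \oo] --> 0.
  by rewrite -[X in _ --> X](mulr0 (K4 * M ^+ 4)); exact: cvgMr.
move=> /cvgrPdist_le /(_ _ e20) [m0 _ hm].
pose m := (m0 + 2)%N.
have m1 : (1 < m)%N by rewrite /m addn2.
have m0' : (0 < m)%N by exact: ltn_trans m1.
have {hm} Km : K4 * M ^+ 4 * w m <= e / 2.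
  have := hm m (leq_addr _ _); rewrite sub0r normrN; apply: le_trans;
    exact: ler_norm.
pose G (A : R) := damp s A * mean (@stat (osc (s * A) phi) m).
have cG : {for 0, continuous G}.
  apply: cvgM.
    apply: (@cvg_comp _ _ _ (fun A => - (s ^+ 2 * v * (1 - A ^+ 2) / 2)) expR);
      last exact: continuous_expR.
    apply: cvgN; apply: cvgMl; apply: cvgMr; apply: cvgB; first exact: cvg_cst.
    exact: sqr_continuous.
  rewrite /mean; apply: cvg_big => [|p _];
    first exact: add_continuous. apply: cvgMr; rewrite /stat /osc.
  apply: (@cvg_comp _ _ _ (fun A => s * A * _ + phi) cos);
    last exact: continuous_cos.
  apply: cvgD; last exact: cvg_cst.
  by apply: cvgMl; apply: cvgMr; exact: cvg_id.
have cA : decay theta c m n @[n --> \oo] --> 0.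
  have := c_lt m1; have c0 : 0 < c by move: alpha_lt1; lra.
  by move=> cm; apply: cvg_decay => //; [exact: (ntheta_gt0 alpha_lt1)|exact: ltW].
have G0 : G 0 = expR (- (s ^+ 2 * v / 2)) * cos phi.
  rewrite /G expr0n subr0 mulr1 mulr0; congr (_ * _).
  rewrite -[RHS](mean_cst EP (cos phi) m0'); apply: eq_bigr => p _.
  by rewrite /stat /osc mul0r add0r.
have : G (decay theta c m n) @[n --> \oo] --> expR (- (s ^+ 2 * v / 2)) * cos phi.
  by rewrite -G0; exact: (cvg_comp _ _ cA cG).
move=> /cvgrPdist_le /(_ _ e20) cGA; near=> n.
have mn : (m <= n)%N by near: n; exact: nbhs_infty_ge.
have h1 : `|expR (- (s ^+ 2 * v / 2)) * cos phi - G (decay theta c m n)| <= e / 2.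
  by near: n; exact: cGA.
have := mean_osc_iter phi m1 M1 sM (erefl (decay theta c m (m + (n - m))));
  rewrite subnKC// => h2.
rewrite -[X in `|X|](subrKA (G (decay theta c m n))) (splitr e).
apply: le_trans (ler_normD _ _) _; apply: lerD => //.
rewrite distrC; apply: le_trans h2 _; apply: le_trans Km.
by rewrite ler_wpM2l// gerBl ltW.
Unshelve. all: by end_near. Qed.

End Oscillation.

(** * Gaussian integrals *)

Section NormalIntegral.
Variables (R : realType) (m s : R).
Local Notation mu := (@lebesgue_measure R).

(** [normal_pdf] and the Radon-Nikodym derivative have the same integral over every measurable set,
    hence agree almost everywhere. *)
Lemma integral_normal_prob (f : R -> \bar R) : measurable_fun setT f ->
  (\int[normal_prob m s]_x `|f x| < +oo)%E ->
  (\int[normal_prob m s]_x f x = \int[mu]_x (f x * (normal_pdf m s x)%:E))%E.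
Proof.
move=> mf finf.
have dom := @normal_prob_dominates R m s.
rewrite -(Radon_Nikodym_change_of_variables dom)//=; last first.
  by apply/integrableP; split.
have mpdf : measurable_fun setT (EFin \o normal_pdf m s).
  by apply/measurable_EFinP; exact: measurable_normal_pdf.
apply: ae_eq_integral => //.
- exact: emeasurable_funM.
- exact: emeasurable_funM.
- apply: ae_eqe_mul2l => /=.
  rewrite Radon_NikodymE/=.
  case: cid => /= h [h1 h2 h3].
  by apply: integral_ae_eq => //= E E01 mE; rewrite -h3.
Qed.

End NormalIntegral.

(** * Characteristic function and tail of the centered Gaussian law *)

Section Gaussian.
Variables (R : realType) (s : R).
Hypothesis s_gt0 : 0 < s.
Local Notation mu := (@lebesgue_measure R).
Local Notation p := (normal_pdf 0 s).

Let sn0 : s != 0. Proof. by rewrite gt_eqF. Qed.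

Lemma is_derive_normal_pdf (x : R) : is_derive x 1 p (- (x / s ^+ 2) * p x).
Proof.
rewrite normal_pdfE// /normal_fun.
have : is_derive x 1 (fun x : R => - (x - 0) ^+ 2 / (s ^+ 2 *+ 2)) (- (x / s ^+ 2)).
  apply: is_derive_eq; rewrite /GRing.scale/= mulr2n; field.
  by rewrite sn0 -mulr2n mulrn_eq0 expf_eq0 /= sn0.
move=> h; apply: is_derive_eq; rewrite /GRing.scale/=; ring.
Qed.

(** A quadratic factor is absorbed by doubling the standard deviation: the exponentials differ by
    exp (- 3 z / 8) with z = x^2 / s^2, and 1 + s^2 z <= (1 + 8 s^2 / 3) (1 + 3 z / 8). *)
Lemma normal_pdf_tail x : (1 + x ^+ 2) * p x <=
  (1 + 8 / 3 * s ^+ 2) * normal_peak s / normal_peak (2 * s) * normal_pdf 0 (2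
    * s) x.
Proof.
have s2n0 : 2 * s != 0 by rewrite mulf_neq0.
rewrite !normal_pdfE// /normal_fun subr0.
set C := 1 + 8 / 3 * s ^+ 2.
have -> : C * normal_peak s / normal_peak (2 * s) *
   (normal_peak (2 * s) * expR (- x ^+ 2 / ((2 * s) ^+ 2 *+ 2))) =
   normal_peak s * (C * expR (- x ^+ 2 / ((2 * s) ^+ 2 *+ 2))).
  by field; rewrite gt_eqF ?normal_peak_gt0.
rewrite mulrCA ler_wpM2l ?normal_peak_ge0//.
have -> : - x ^+ 2 / (s ^+ 2 *+ 2) =
   - x ^+ 2 / ((2 * s) ^+ 2 *+ 2) - 3 / 8 * (x ^+ 2 / s ^+ 2).
  rewrite exprMn (_ : 2 ^+ 2 = 4); last by ring.
  have Sn0 : s ^+ 2 != 0 by rewrite expf_eq0.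
  move: (s ^+ 2) (x ^+ 2) Sn0 => S X Sn0;
    rewrite -(mulr_natr S) -(mulr_natr (4 * S)).
  by field.
rewrite expRD [leLHS]mulrCA [leRHS]mulrC ler_wpM2l ?expR_ge0//.
have z0 : 0 <= x ^+ 2 / s ^+ 2 by rewrite divr_ge0 ?sqr_ge0.
rewrite [X in (1 + X) * _](_ : _ = s ^+ 2 * (x ^+ 2 / s ^+ 2)); last by field.
move: (x ^+ 2 / s ^+ 2) z0 => z z0.
rewrite expRN ler_pdivrMr ?expR_gt0//.
have h := expR_ge1Dx (3 / 8 * z).
have s20 := sqr_ge0 s.
have C0 : 0 <= C by rewrite /C addr_ge0// mulr_ge0.
apply: le_trans (ler_wpM2l C0 h).
rewrite /C; have : 0 <= s ^+ 2 * z by rewrite mulr_ge0.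
lra.
Qed.

Lemma integrable_normal_pdf_sqr :
  mu.-integrable setT (fun x => ((1 + x ^+ 2) * p x)%:E).
Proof.
pose C := (1 + 8 / 3 * s ^+ 2) * normal_peak s / normal_peak (2 * s).
have ig : mu.-integrable setT (fun x => (C%:E * (normal_pdf 0 (2 * s) x)%:E)%E).
  apply: integrableZl => //; exact: integrable_normal_pdf.
apply: (le_integrable measurableT _ _ ig).
- apply/measurable_EFinP/measurable_funM; last exact: measurable_normal_pdf.
  exact: measurable_funD.
- move=> x _; rewrite -EFinM !abse_EFin lee_fin.
  rewrite !ger0_norm ?normal_pdf_tail//.
    by rewrite !mulr_ge0 ?normal_pdf_ge0 ?invr_ge0 ?normal_peak_ge0//
      addr_ge0// mulr_ge0 ?sqr_ge0.
  by rewrite mulr_ge0 ?normal_pdf_ge0// addr_ge0 ?sqr_ge0.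
Qed.

Lemma integrable_le_pdf (f : R -> R) (C : R) : measurable_fun setT f ->
  (forall x, `|f x| <= C * ((1 + x ^+ 2) * p x)) -> mu.-integrable setT (EFin \o f).
Proof.
move=> mf fC.
have ig : mu.-integrable setT (fun x => (C%:E * ((1 + x ^+ 2) * p x)%:E)%E).
  apply: integrableZl => //; exact: integrable_normal_pdf_sqr.
apply: (le_integrable measurableT _ _ ig).
- exact/measurable_EFinP.
- by move=> x _; rewrite -EFinM !abse_EFin lee_fin;
  apply: le_trans (fC x) (ler_norm _).
Qed.

(** Serves as integration by parts on the whole line: the fundamental theorem on [-n-1, n+1],
    dominated convergence for h, and decay of H at infinity. *)
Lemma Rintegral_derive_eq0 (h H : R -> R) (C : R) :
  continuous h -> (forall x : R, is_derive x 1 H (h x)) ->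
  (forall x, `|h x| <= C * ((1 + x ^+ 2) * p x)) ->
  (forall x, `|H x| <= C * p x) ->
  \int[mu]_x h x = 0.
Proof.
move=> ch Hh hC HC.
have mh : measurable_fun setT h by exact: continuous_measurable_fun.
have ih := integrable_le_pdf mh hC.
pose h_ n : R -> \bar R := fun x => ((h \_ `[- n.+1%:R, n.+1%:R]%classic) x)%:E.
have mh_ n : measurable_fun setT (h_ n).
  apply/measurable_EFinP/(measurable_restrictT _ _).1 => //.
  exact: measurable_funTS.
have ig : mu.-integrable setT (fun x => (C%:E * ((1 + x ^+ 2) * p x)%:E)%E).
  apply: integrableZl => //; exact: integrable_normal_pdf_sqr.
have cvgh : {ae mu, forall x, setT x -> h_ ^~ x @ \oo --> (EFin \o h) x}.
  apply: aeW => x _; apply: cvg_near_cst; near=> n.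
  rewrite /h_ patchE mem_set//= in_itv/= -ler_norml.
  apply: (@le_trans _ _ n%:R); last by rewrite ler_nat.
  near: n; exact: nbhs_infty_ger.
have domh : {ae mu, forall x n, setT x -> (`|h_ n x| <= C%:E * ((1 + x ^+ 2) *
  p x)%:E)%E}.
  apply: aeW => x n _; rewrite /h_ patchE -EFinM abse_EFin lee_fin.
  by case: ifPn => _; rewrite ?normr0 ?(le_trans _ (hC x)).
have [_ _] := @dominated_convergence _ _ _ mu setT measurableT h_ (EFin \o h) _
  mh_ ((measurable_EFinP _ _).2 mh) cvgh ig domh.
have -> : [sequence (\int[mu]_(x in setT) h_ n x)%E]_n =
    (fun n => (H n.+1%:R - H (- n.+1%:R))%:E).
  apply/funext => n; rewrite /h_.
  have := @continuous_FTC2 R h H (- n.+1%:R) n.+1%:R.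
  rewrite -EFinB => <-.
  - by rewrite [RHS]integral_mkcond restrict_EFin.
  - by rewrite gtrN.
  - exact: continuous_subspaceT.
  - have dH x : derivable H x 1 by exact: ex_derive.
    have cH x : {for x, continuous H}
      by exact/differentiable_continuous/derivable1_diffP.
    split; [by []| |].
      by apply: cvg_at_right_filter; exact: cH.
    by apply: cvg_at_left_filter; exact: cH.
  - by move=> x _; rewrite derive1E derive_val.
pose K := `|C| * ((1 + 8 / 3 * s ^+ 2) * normal_peak s).
have K0 : 0 <= K.
  by rewrite !mulr_ge0 ?normal_peak_ge0// addr_ge0// mulr_ge0// sqr_ge0.
have s2n0 : 2 * s != 0 by rewrite mulf_neq0.
have Hb x : `|H x| <= K / (1 + x ^+ 2).
  have x20 : 0 < 1 + x ^+ 2 by rewrite ltr_wpDr ?sqr_ge0.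
  apply: le_trans (HC x) _; rewrite ler_pdivlMr// -mulrA.
  apply: (@le_trans _ _ (`|C| * (p x * (1 + x ^+ 2)))).
    by rewrite ler_wpM2r ?ler_norm// mulr_ge0 ?normal_pdf_ge0// ltW.
  rewrite ler_wpM2l// mulrC; apply: le_trans (normal_pdf_tail x) _.
  have c0 : 0 <= (1 + 8 / 3 * s ^+ 2) * normal_peak s.
    by rewrite mulr_ge0 ?normal_peak_ge0// addr_ge0// mulr_ge0// sqr_ge0.
  rewrite -mulrA; apply: ler_piMr => //.
  by rewrite mulrC ler_pdivrMr ?normal_peak_gt0// mul1r normal_pdf_ub.
have H0 (f : nat -> R) : (forall n, n.+1%:R <= 1 + f n ^+ 2) ->
    H (f n) @[n --> \oo] --> 0.
  move=> fn; apply: norm_cvg0.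
  apply: (@squeeze_cvgr _ _ _ _ (fun=> 0) (fun n => K * harmonic n)).
  - near=> n; rewrite normr_ge0/=; apply: le_trans (Hb _) _.
    by rewrite ler_wpM2l// lef_pV2// posrE// ltr_wpDr ?sqr_ge0.
  - exact: cvg_cst.
  - by rewrite -[X in _ --> X](mulr0 K); apply: cvgMr; exact: cvg_harmonic.
have nn n : n.+1%:R <= 1 + n.+1%:R ^+ 2 :> R.
  have : 1 <= n.+1%:R :> R by rewrite ler1n.
  by move: n.+1%:R => z z1; nra.
have c0 : (H n.+1%:R - H (- n.+1%:R))%:E @[n --> \oo] --> 0%:E.
  apply: cvg_EFin; first exact: nearW.
  rewrite -[X in _ --> X](subr0 0); apply: cvgB; first exact: H0.
  by apply: (H0 (fun n => - n.+1%:R)) => n; rewrite sqrrN.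
by move=> /(cvg_unique _ c0) /(congr1 fine) /= e; rewrite /Rintegral -e.
Unshelve. all: by end_near. Qed.


Let g (phi t x : R) : R := cos (t * x + phi) * p x.

Let dg (phi t x : R) : R := - (x * sin (t * x + phi)) * p x.

Let continuous_pdf : continuous p. Proof. exact: continuous_normal_pdf. Qed.

Let is_derive_g (phi t x : R) : is_derive t 1 (fun t => g phi t x) (dg phi t x).
Proof. by rewrite /g; apply: is_derive_eq; rewrite /GRing.scale/= /dg; ring. Qed.

Let pdf_le x : p x <= (1 + x ^+ 2) * p x.
Proof. by rewrite ler_peMl ?normal_pdf_ge0// lerDl sqr_ge0. Qed.

Let normx_le x : `|x| * p x <= (1 + x ^+ 2) * p x.
Proof.
rewrite ler_wpM2r ?normal_pdf_ge0// -(real_normK (num_real x)).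
by have := sqr_ge0 (`|x| - 1); have := normr_ge0 x; nra.
Qed.

Let continuous_arg (phi t : R) : continuous (fun x : R => t * x + phi).
Proof.
by move=> x; apply: cvgD; [apply: cvgMr; exact: cvg_id|exact: cvg_cst].
Qed.

Let measurable_g phi t : measurable_fun setT (g phi t).
Proof.
apply: measurable_funM; last exact: measurable_normal_pdf.
apply: continuous_measurable_fun => x; apply: continuous_comp.
  exact: continuous_arg.
exact: continuous_cos.
Qed.

Let g_le phi t x : `|g phi t x| <= 1 * ((1 + x ^+ 2) * p x).
Proof.
rewrite normrM (ger0_norm (normal_pdf_ge0 _ _ _)); apply: ler_pM => //.
  exact: normal_pdf_ge0.
exact: cos_max.
Qed.

Let Phi phi t := \int[mu]_x g phi t x.

(** The classical differential equation of the Gaussian characteristic function. Differentiation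
    under the integral gives the integral of [dg]; since x p(x) = - s^2 p'(x), integrating the
    derivative of sin (t x + phi) p(x) brings it back to [Phi]. *)
Let is_derive_Phi (phi t : R) :
  is_derive t 1 (Phi phi) (- (t * s ^+ 2) * Phi phi t).
Proof.
have It : `](t - 1), (t + 1)[%classic t
  by rewrite /= in_itv/= gtrBl ltr01 ltrDl ltr01.
have intg x : `](t - 1), (t + 1)[%classic x -> mu.-integrable setT (EFin \o g
  phi x).
  move=> _; exact: (integrable_le_pdf (measurable_g phi x) (g_le phi x)).
have derg t' x : `](t - 1), (t + 1)[%classic t' -> setT x -> derivable ((g
  phi)^~ x) t' 1.
  by move=> _ _; have := is_derive_g phi t' x => h; apply: ex_derive.
have dgE t' x : partial1of2 (g phi) t' x = dg phi t' x.
  by have := is_derive_g phi t' x => h; rewrite partial1of2E; exact: derive_val.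
have G0 x : 0 <= (1 + x ^+ 2) * p x.
  by rewrite mulr_ge0 ?normal_pdf_ge0// addr_ge0 ?sqr_ge0.
have Gub t' x : `](t - 1), (t + 1)[%classic t' -> setT x ->
    `|partial1of2 (g phi) t' x| <= (1 + x ^+ 2) * p x.
  move=> _ _; rewrite dgE /dg normrM normrN normrM (ger0_norm (normal_pdf_ge0 _
    _ _)).
  apply: le_trans (normx_le x); rewrite ler_wpM2r ?normal_pdf_ge0//.
  by rewrite ler_piMr// sin_max.
have dPhi : derivable (Phi phi) t 1.
  exact: (derivable_under_integral measurableT It intg derg G0
    integrable_normal_pdf_sqr Gub).
apply: DeriveDef => //.
rewrite -derive1E.
rewrite (differentiation_under_integral measurableT It intg derg G0
  integrable_normal_pdf_sqr Gub).
under eq_Rintegral do rewrite dgE.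
have mdg : measurable_fun setT (dg phi t).
  apply: measurable_funM; last exact: measurable_normal_pdf.
  apply: continuous_measurable_fun => x; apply: cvgN; apply: cvgM;
    first exact: cvg_id.
  by apply: continuous_comp; [exact: continuous_arg|exact: continuous_sin].
have dg_le x : `|dg phi t x| <= 1 * ((1 + x ^+ 2) * p x).
  by rewrite mul1r -dgE Gub.
have idg := integrable_le_pdf mdg dg_le.
have ig := integrable_le_pdf (measurable_g phi t) (g_le phi t).
pose H x := sin (t * x + phi) * p x.
pose h x := t * g phi t x + (s ^+ 2)^-1 * dg phi t x.
have Sn0 : s ^+ 2 != 0 by rewrite expf_eq0.
have Hh (x : R) : is_derive x 1 H (h x).
  have := is_derive_normal_pdf x => dp.
  by apply: is_derive_eq; rewrite /GRing.scale/= /h /g /dg; ring.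
have : \int[mu]_x h x = 0.
  (* One constant must dominate both: 1 suffices for H, |t| + s^-2 for h. *)
  apply: (@Rintegral_derive_eq0 h H (1 + (`|t| + (s ^+ 2)^-1))) => //.
  - move=> x; apply: cvgD; apply: cvgMr.
      apply: cvgM; last exact: continuous_pdf.
      by apply: continuous_comp; [exact: continuous_arg|exact: continuous_cos].
    apply: cvgM; last exact: continuous_pdf.
    apply: cvgN; apply: cvgM; first exact: cvg_id.
    by apply: continuous_comp; [exact: continuous_arg|exact: continuous_sin].
  - move=> x; apply: (@le_trans _ _ ((`|t| + (s ^+ 2)^-1) * ((1 + x ^+ 2) * p
    x))); last first.
      by rewrite ler_wpM2r// lerDr.
    rewrite mulrDl; apply: le_trans (ler_normD _ _) _; apply: lerD.
      by rewrite normrM ler_wpM2l//; have := g_le phi t x; rewrite mul1r.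
    rewrite normrM ger0_norm ?invr_ge0 ?sqr_ge0// ler_wpM2l ?invr_ge0 ?sqr_ge0//.
    by have := dg_le x; rewrite mul1r.
  - by move=> x; rewrite normrM (ger0_norm (normal_pdf_ge0 _ _ _)) ler_wpM2r
    ?normal_pdf_ge0//; apply: le_trans (sin_max _) _;
    rewrite lerDl addr_ge0// invr_ge0 sqr_ge0.
rewrite /h RintegralD//=; last 2 first.
  - exact: (integrableZl measurableT t ig).
  - exact: (integrableZl measurableT (s ^+ 2)^-1 idg).
rewrite !RintegralZl// => /eqP; rewrite addrC addr_eq0 => /eqP e.
rewrite -[LHS](mulVKf Sn0) e /Phi; ring.
Qed.

Let Phi0 phi : Phi phi 0 = cos phi.
Proof.
rewrite /Phi /g (_ : (fun x => _) = (fun x => cos phi * p x)); last first.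
  by apply/funext => x; rewrite mul0r add0r.
rewrite RintegralZl//; last exact: integrable_normal_pdf.
by rewrite /Rintegral integral_normal_pdf mulr1.
Qed.

Let PhiE phi t : Phi phi t = expR (- (t ^+ 2 * s ^+ 2 / 2)) * cos phi.
Proof.
pose F t := expR (t ^+ 2 * s ^+ 2 / 2) * Phi phi t.
have F0 : F t = F 0.
  apply: is_derive_0_is_cst => {}t; have := is_derive_Phi phi t => dP.
  by apply: is_derive_eq; rewrite /GRing.scale/=; field.
rewrite expRN -[LHS](mulKf (lt0r_neq0 (expR_gt0 (t ^+ 2 * s ^+ 2 / 2)))).
congr (_ * _); rewrite -/(F t) F0 /F Phi0 expr0n/= !mul0r.
by rewrite expR0 mul1r.
Qed.

Lemma normal_prob_cos (t phi : R) :
  (\int[normal_prob 0 s]_x (cos (t * x + phi))%:E =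
   (expR (- (t ^+ 2 * s ^+ 2 / 2)) * cos phi)%:E)%E.
Proof.
have mc : measurable_fun setT (fun x : R => cos (t * x + phi)).
  apply: continuous_measurable_fun => x; apply: continuous_comp.
    exact: continuous_arg.
  exact: continuous_cos.
rewrite integral_normal_prob.
- rewrite -PhiE /Phi /Rintegral fineK//.
  apply: integrable_fin_num => //.
  exact: (integrable_le_pdf (measurable_g phi t) (g_le phi t)).
- exact/measurable_EFinP.
- apply: (@le_lt_trans _ _ (\int[normal_prob 0 s]_x (cst 1 x)))%E.
    apply: ge0_le_integral => //=.
      apply/measurable_EFinP. exact: measurableT_comp.
    by move=> x _; rewrite lee_fin cos_max.
  by rewrite integral_cst//= probability_setT mule1 ltry.
Qed.


(** The cost, under the limit law, of changing a test function beyond L. Only the finiteness of V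
    matters, so 1 plus the second moment is taken. *)
Lemma normal_prob_tail : exists V : R, forall L : R, 0 < L ->
  (\int[normal_prob 0 s]_x (Num.min 1 ((x / L) ^+ 2))%:E <= (V / L ^+ 2)%:E)%E.
Proof.
exists (\int[mu]_x ((1 + x ^+ 2) * p x)) => L L0.
have mn0 x : 0 <= Num.min 1 ((x / L) ^+ 2) by rewrite le_min ler01 sqr_ge0.
have mx : measurable_fun setT (fun x : R => Num.min 1 ((x / L) ^+ 2)).
  apply: measurable_minr => //; apply: measurable_funX; exact: measurable_funM.
rewrite integral_normal_prob.
- rewrite mulrC /Rintegral -[(L ^+ 2)^-1]/(fine (L ^+ 2)^-1%:E) -fineM//;
  last first.
    exact: integrable_fin_num integrable_normal_pdf_sqr.
  rewrite fineK; last first.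
    by rewrite fin_numM//; exact: integrable_fin_num integrable_normal_pdf_sqr.
  rewrite -integralZl//; last exact: integrable_normal_pdf_sqr.
  apply: ge0_le_integral => //.
  - by move=> x _; rewrite -EFinM lee_fin mulr_ge0 ?normal_pdf_ge0.
  - by apply: emeasurable_funM; apply/measurable_EFinP => //;
    exact: measurable_normal_pdf.
  - apply: emeasurable_funM => //; apply/measurable_EFinP/measurable_funM;
    last exact: measurable_normal_pdf.
    exact: measurable_funD.
  move=> x _; rewrite -!EFinM lee_fin mulrA ler_wpM2r ?normal_pdf_ge0//.
  rewrite ge_min expr_div_n; apply/orP; right.
  by rewrite mulrC ler_wpM2l ?invr_ge0 ?sqr_ge0// lerDr.
- exact/measurable_EFinP.
- apply: (@le_lt_trans _ _ (\int[normal_prob 0 s]_x (cst 1 x)))%E.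
    apply: ge0_le_integral => //=.
      by apply/measurable_EFinP; exact: measurableT_comp.
    by move=> x _; rewrite lee_fin ger0_norm// ge_min lexx.
  by rewrite integral_cst//= probability_setT mule1 ltry.
Qed.

End Gaussian.

(** * Trigonometric approximation *)

Section Bernstein.
Variable R : realType.

(* [bernstein n G] at y is the mean of G at a binomial (n, y) variable. *)
Fixpoint bernstein (n : nat) (G : nat -> R) : {poly R} :=
  if n is n'.+1 then
    'X * bernstein n' (fun k => G k.+1) + (1 - 'X) * bernstein n' G
  else (G 0)%:P.

(* The factor of C is the mean of (k - c)^2 under the binomial law (n, y). *)
Lemma bernstein_bound n G (a e C c y : R) : 0 <= y <= 1 -> 0 <= C ->
  (forall k, `|G k - a| <= e + C * (k%:R - c) ^+ 2) ->
  `|(bernstein n G).[y] - a| <= e + C * (n%:R * y * (1 - y) + (n%:R * y - c) ^+ 2).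
Proof.
move=> /andP[y0 y1] C0; elim: n G c => [|n IH] G c Gc /=.
  by rewrite hornerC; have := Gc 0%N; rewrite !mul0r !add0r.
have h1 := IH _ _ Gc.
have h2 : forall k, `|G k.+1 - a| <= e + C * (k%:R - (c - 1)) ^+ 2.
  move=> k; rewrite (_ : _ - (c - 1) = k.+1%:R - c); first exact: Gc.
  by rewrite -natr1; ring.
have {}h2 := IH _ _ h2.
rewrite !hornerE.
have y1' : 0 <= 1 - y by rewrite subr_ge0.
set u := _.[y] in h2 *; set w := _.[y] in h1 *.
rewrite (_ : _ - a = y * (u - a) + (1 - y) * (w - a)); last by ring.
apply: le_trans (ler_normD _ _) _; rewrite !normrM (ger0_norm y0) (ger0_norm y1').
apply: le_trans (lerD (ler_wpM2l y0 h2) (ler_wpM2l y1' h1)) _.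
rewrite -natr1 le_eqVlt; apply/orP; left; apply/eqP; ring.
Qed.

(** Only x is confined to the segment: y will be a node k / n, where [bernstein_bound] lets k range
    over all integers. *)
Lemma uniform_continuous_segment (F : R -> R) (a b e : R) : continuous F -> 0 < e ->
  exists2 dl, 0 < dl & forall x y, a <= x <= b -> `|x - y| < dl -> `|F x - F y|
    <= e.
Proof.
move=> cF e0.
have := @segment_compact R a b; rewrite compact_near_coveringP => nc.
have Pnear : forall x, `[a, b]%classic x -> \forall x' \near x & dl \near 0^'+,
    forall y, `|x' - y| < dl -> `|F x' - F y| <= e.
  move=> x _; have /cvgrPdist_lt/(_ (e / 2)) := cF x.
  rewrite divr_gt0// => /(_ isT) /nbhs_ballP[eta /= eta0 Feta].
  have eta20 : 0 < eta / 2 by rewrite divr_gt0.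
  exists (ball x (eta / 2), [set dl | dl < eta / 2]) => /=.
    by split; [exact: nbhsx_ballx|exact: nbhs_right_lt].
  move=> [x' dl] /= [xx' dleta] y x'y.
  have F1 : `|F x - F x'| < e / 2.
    by apply: Feta; apply: lt_trans xx' _; rewrite ltr_pdivrMr// ltr_pMr// ltr1n.
  have F2 : `|F x - F y| < e / 2.
    apply: Feta; rewrite /ball/= -(subrKA x') (splitr eta).
    apply: le_lt_trans (ler_normD _ _) _; apply: ltrD; first exact: xx'.
    exact: lt_trans x'y dleta.
  rewrite -(subrKA (F x)) (splitr e); apply: le_trans (ler_normD _ _) _.
  by rewrite distrC; apply: lerD; exact: ltW.
have : \forall dl \near 0^'+, `[a, b]%classic `<=`
    (fun x => forall y, `|x - y| < dl -> `|F x - F y| <= e).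
  exact: (nc _ _ _ _ Pnear).
move=> near0; near (0 : R)^'+ => dl; exists dl.
  by near: dl; exact: nbhs_right_gt.
move=> x y xab; have : `[a, b]%classic `<=`
    (fun x => forall y, `|x - y| < dl -> `|F x - F y| <= e) by near: dl.
by apply; rewrite /= in_itv.
Unshelve. all: by end_near. Qed.

Lemma bernstein_approx (F : R -> R) (B e : R) : continuous F ->
  (forall x, `|F x| <= B) -> 0 < e ->
  exists q : {poly R}, forall y, 0 <= y <= 1 -> `|q.[y] - F y| <= e.
Proof.
move=> cF FB e0; have e20 : 0 < e / 2 by rewrite divr_gt0.
have B0 : 0 <= B by exact: le_trans (normr_ge0 (F 0)) (FB 0).
have [dl dl0 Fdl] := uniform_continuous_segment 0 1 cF e20.
(* Chebyshev's device: when |y - k / n| >= dl, the oscillation 2 B of F is at most C (y - k / n)^2,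
   whose binomial mean is C y (1 - y) / n; n is then chosen so that C / n <= e / 2. *)
pose C := 2 * B / dl ^+ 2.
have C0 : 0 <= C by rewrite divr_ge0 ?sqr_ge0// mulr_ge0.
pose n := (Num.truncn (2 * C / e)).+1.
have n0 : 0 < n%:R :> R by rewrite ltr0n.
have Cn : C / n%:R <= e / 2.
  rewrite ler_pdivrMr//; have := truncnS_gt (2 * C / e); rewrite -/n ltr_pdivrMr//.
  by lra.
exists (bernstein n (fun k => F (k%:R / n%:R))) => y y01.
have /andP[y0 y1] := y01.
have nn0 := lt0r_neq0 n0.
have := @bernstein_bound n (fun k => F (k%:R / n%:R)) (F y) (e / 2) (C / n%:R ^+ 2)
  (n%:R * y) y y01.
rewrite divr_ge0 ?sqr_ge0// => /(_ isT) h; apply: le_trans (h _) _.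
  move=> k; rewrite distrC.
  have -> : C / n%:R ^+ 2 * (k%:R - n%:R * y) ^+ 2 = C * (y - k%:R / n%:R) ^+ 2.
    by field.
  have [ydl|ydl] := ltP `|y - k%:R / n%:R| dl.
    by apply: le_trans (Fdl _ _ y01 ydl) _; rewrite lerDl mulr_ge0 ?sqr_ge0.
  apply: (@le_trans _ _ (2 * B)).
    by apply: le_trans (ler_normB _ _) _; rewrite mulr2n mulrDl mul1r lerD.
  apply: ler_wpDl; first exact: ltW.
  rewrite /C mulrAC ler_pdivlMr ?exprn_gt0// ler_wpM2l ?mulr_ge0//.
  by rewrite -(real_normK (num_real (y - _))) ler_pXn2r ?nnegrE// ltW.
rewrite subrr expr0n addr0 [leRHS](splitr e) lerD2l; apply: le_trans Cn.
have -> : C / n%:R ^+ 2 * (n%:R * y * (1 - y)) = C / n%:R * (y * (1 - y)) by field.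
apply: ler_piMr; first by rewrite divr_ge0// ler0n.
by rewrite mulr_ile1 ?subr_ge0// gerBl.
Qed.

End Bernstein.

Section SineApprox.
Variable R : realType.

(** On [-L, L] the sine is invertible, so f is a continuous function of sin (k x). Beyond L the
    approximation stays bounded by periodicity, and the loss 2 B is charged to a function whose mean
    is controlled by second moments. *)
Lemma sine_poly_approx (f : R -> R) (B L e : R) : continuous f ->
  (forall x, `|f x| <= B) -> 0 < L -> 0 < e ->
  exists q : {poly R}, exists k : R, forall x,
    `|f x - q.[sin (k * x)]| <= e + 2 * B * Num.min 1 ((x / L) ^+ 2).
Proof.
move=> cf fB L0 e0.
have B0 : 0 <= B by apply: le_trans (fB 0); exact: normr_ge0.
(* k is such that k x lies in [-1/2, 1/2], where sin can be inverted, for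
   |x| <= L; the clamp keeps asin inside ]-1, 1[. *)
pose k := (2 * L)^-1; have k0 : 0 < k by rewrite invr_gt0 mulr_gt0.
pose clamp (y : R) := Num.max (- 2^-1) (Num.min 2^-1 y).
pose F (y : R) := f (asin (clamp (2 * y - 1)) / k).
have cclamp : continuous clamp.
  move=> y; apply: (@continuous_max R R (fun=> - 2^-1) _ y); first exact: cvg_cst.
  apply: (@continuous_min R R (fun=> 2^-1) _ y); first exact: cvg_cst.
  exact: cvg_id.
have clampE y : -1 < clamp y < 1.
  rewrite /clamp lt_max gt_max gt_min; apply/andP; split;
    first by rewrite ltrN2 invf_lt1 ?ltr1n.
  by rewrite (lt_trans (y := 0)) ?oppr_lt0//= invf_lt1 ?ltr1n.
have cF : continuous F.
  move=> y; apply: (@cvg_comp _ _ _ (fun y => asin (clamp (2 * y - 1)) / k) f);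
    last exact: cf.
  apply: cvgMl; apply: (@cvg_comp _ _ _ (fun y => clamp (2 * y - 1)) asin);
    last first.
    by apply: continuous_asin; exact: clampE.
  apply: (@cvg_comp _ _ _ (fun y : R => 2 * y - 1) clamp); last exact: cclamp.
  by apply: cvgB; [apply: cvgMr; exact: cvg_id|exact: cvg_cst].
have [q qF] := bernstein_approx cF (fun y => fB _) e0.
(* (X + 1) / 2 carries the range [-1, 1] of the sine to the segment [0, 1] of [bernstein_approx]. *)
exists (q \Po (2^-1%:P * ('X + 1))), k => x.
rewrite horner_comp !hornerE.
set y := _ * _; have y01 : 0 <= y <= 1.
  have := sin_le1 (k * x); have := sin_geN1 (k * x); rewrite /y; lra.
have yE : 2 * y - 1 = sin (k * x) by rewrite /y; lra.
have qy := qF y y01.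
have [xL|xL] := lerP `|x| L.
  have kx : `|k * x| <= 2^-1.
    rewrite normrM gtr0_norm// /k invfM -mulrA ler_piMr//.
    by rewrite mulrC ler_pdivrMr// mul1r.
  have sx : `|sin (k * x)| <= 2^-1 by exact: le_trans (normr_sin_le _) kx.
  have -> : f x = F y.
    rewrite /F yE; congr f.
    have -> : clamp (sin (k * x)) = sin (k * x).
      move: sx; rewrite ler_norml => /andP[s1 s2].
      by rewrite /clamp (min_idPr s2) (max_idPr s1).
    rewrite sinK; first by rewrite mulrC mulKf// gt_eqF.
    rewrite in_itv/= -ler_norml; apply: le_trans kx _.
    by have := pi_ge2 R; lra.
  rewrite distrC; apply: le_trans qy _; rewrite lerDl mulr_ge0 ?mulr_ge0//.
  by rewrite le_min ler01 sqr_ge0.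
have -> : Num.min 1 ((x / L) ^+ 2) = 1.
  apply/min_idPl; rewrite -(real_normK (num_real (x / L))) exprn_ege1//.
  by rewrite normf_div (gtr0_norm L0) ler_pdivlMr// mul1r ltW.
rewrite mulr1 -(subrKA (F y)) addrC; apply: le_trans (ler_normD _ _) _.
rewrite distrC; apply: lerD => //; apply: le_trans (ler_normB _ _) _.
by rewrite mulr_natl mulr2n; apply: lerD; exact: fB.
Qed.

End SineApprox.

(** * Convergence in law *)

Section CentralLimit.
Context (d : measure_display) (T : measurableType d) (R : realType).
Variables (P : probability T R) (alpha theta : R).
Variable Pi : forall n : nat, T -> {set {set 'I_n}}.
Hypothesis EP : ewens_pitman P alpha theta Pi.
Hypotheses (alpha_gt0 : 0 < alpha) (alpha_lt1 : alpha < 1).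
Hypothesis alpha_theta_gt0 : 0 < alpha + theta.

Local Notation v := (alpha * (1 - alpha)).
Local Notation N := (normal_prob 0 (Num.sqrt v)).

Let v_gt0 : 0 < v. Proof. by rewrite mulr_gt0// subr_gt0. Qed.

Let sv_gt0 : 0 < Num.sqrt v. Proof. by rewrite sqrtr_gt0. Qed.

Let mX (g : R -> R) n : R :=
  mean P Pi (@stat R alpha (fun x D => g (D / Num.sqrt x)) n).

Let integrable_bounded (g : R -> R) (C : R) : measurable_fun setT g ->
  (forall x, `|g x| <= C) -> N.-integrable setT (EFin \o g).
Proof.
move=> mg gC; apply/integrableP; split; first exact/measurable_EFinP.
apply: (@le_lt_trans _ _ (\int[N]_x (cst C%:E x)))%E.
  apply: ge0_le_integral => //=.
    by apply/measurable_EFinP; exact: measurableT_comp.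
  by move=> x _; rewrite lee_fin.
by rewrite integral_cst//= probability_setT mule1 ltry.
Qed.

Definition test_fun (g : R -> R) : Prop :=
  [/\ measurable_fun setT g, exists C, forall x, `|g x| <= C &
    mX g n @[n --> \oo] --> \int[N]_x g x].

Let mXD g h n : mX (fun x => g x + h x) n = mX g n + mX h n.
Proof. by rewrite /mX -meanD. Qed.

Let mXB g h n : mX (fun x => g x - h x) n = mX g n - mX h n.
Proof. by rewrite /mX -meanB. Qed.

Let mXZ a g n : mX (fun x => a * g x) n = a * mX g n.
Proof. by rewrite /mX -meanZ. Qed.

Let test_funD g h : test_fun g -> test_fun h -> test_fun (fun x => g x + h x).
Proof.
move=> [mg [C gC] cg] [mh [D hD] ch]; split.
- exact: measurable_funD.
- exists (C + D) => x; apply: le_trans (ler_normD _ _) _; exact: lerD.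
- rewrite RintegralD//;
  [|exact: integrable_bounded mg gC|exact: integrable_bounded mh hD].
  by under eq_fun do rewrite mXD; exact: cvgD.
Qed.

Let test_funZ a g : test_fun g -> test_fun (fun x => a * g x).
Proof.
move=> [mg [C gC] cg]; split.
- exact: measurable_funM.
- by exists (`|a| * C) => x; rewrite normrM ler_wpM2l.
- rewrite RintegralZl//; last exact: integrable_bounded mg gC.
  by under eq_fun do rewrite mXZ; exact: cvgMr.
Qed.

Let test_fun_cos s phi : test_fun (fun x => cos (s * x + phi)).
Proof.
split.
- apply: continuous_measurable_fun => x.
  apply: (@cvg_comp _ _ _ (fun x : R => s * x + phi) cos);
    last exact: continuous_cos.
  by apply: cvgD; [apply: cvgMr; exact: cvg_id|exact: cvg_cst].
- by exists 1 => x; exact: cos_max.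
- rewrite /Rintegral normal_prob_cos//= sqr_sqrtr ?(ltW v_gt0)//.
  exact: (cvg_mean_osc EP).
Qed.

(** Product-to-sum: sin (k x) cos a is half the difference of sin (a + k x) and sin (a - k x), and a
    sine is a cosine with phase shifted by pi / 2. This is why an arbitrary phase phi is carried
    along from the start. *)
Let test_fun_sinX_cos k i s phi :
  test_fun (fun x => sin (k * x) ^+ i * cos (s * x + phi)).
Proof.
elim: i s phi => [|i IH] s phi.
  by under eq_fun do rewrite expr0 mul1r; exact: test_fun_cos.
have := test_funD (test_funZ (2^-1) (IH (s + k) (phi - pi / 2)))
  (test_funZ (- 2^-1) (IH (s - k) (phi - pi / 2))).
congr test_fun; apply/funext => x.
rewrite !addrA !cosBpihalf.
have -> : (s + k) * x + phi = (s * x + phi) + k * x by ring.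
have -> : (s - k) * x + phi = (s * x + phi) - k * x by ring.
by rewrite sinB sinD exprS; field.
Qed.

Let test_fun_poly (q : {poly R}) k : test_fun (fun x => q.[sin (k * x)]).
Proof.
have -> : (fun x => q.[sin (k * x)]) =
    (fun x => \sum_(i < size q) (q`_i * (sin (k * x) ^+ i * cos (0 * x + 0)))).
  apply/funext => x; rewrite horner_coef; apply: eq_bigr => i _.
  by rewrite mul0r addr0 cos0 mulr1.
elim: (size q) => [|m IH].
  have := test_funZ 0 (test_fun_cos 0 0); congr test_fun.
  by apply/funext => x; rewrite big_ord0 mul0r.
have := test_funD IH (test_funZ q`_m (test_fun_sinX_cos k m 0 0)); congr test_fun.
by apply/funext => x; rewrite big_ord_recr.
Qed.

Lemma cvg_mX f B : continuous f -> (forall x, `|f x| <= B) ->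
  mX f n @[n --> \oo] --> \int[N]_x f x.
Proof.
move=> cf fB; have mf := continuous_measurable_fun cf.
have B0 : 0 <= B by apply: le_trans (fB 0); exact: normr_ge0.
have [V NV] := normal_prob_tail sv_gt0.
(* A common bound for both laws: the mean of min (1, (x / L)^2) is at most W / L^2 under the
   Gaussian law and under that of X_n. *)
pose W := `|V| + `|var_bound alpha theta|.
have W0 : 0 <= W by rewrite addr_ge0.
apply/cvgrPdist_le => e e0.
(* Two parts for replacing f by the sine polynomial under the Gaussian law, two under the law of
   X_n, one for the convergence of the sine polynomial. L below satisfies L^2 >= L >= 2 B W / e1,
   which brings the tail term under e1. *)
have [e1 e10 eE] : exists2 e1, 0 < e1 & e = 5 * e1.
  by exists (e / 5); [rewrite divr_gt0|field].
pose L := 1 + 2 * B * W / e1.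
have BW0 : 0 <= 2 * B * W by rewrite !mulr_ge0.
have L1 : 1 <= L by rewrite lerDl divr_ge0// ltW.
have L0 : 0 < L by exact: lt_le_trans L1.
have L20 : 0 < L ^+ 2 by rewrite exprn_gt0.
have BL : 2 * B * (W / L ^+ 2) <= e1.
  rewrite mulrA ler_pdivrMr//; apply: (@le_trans _ _ (e1 * L)).
    have e1n := lt0r_neq0 e10.
    rewrite (_ : e1 * L = e1 + 2 * B * W); last by rewrite /L; field.
    by rewrite lerDr ltW.
  by rewrite ler_wpM2l ?(ltW e10)// expr2 ler_peMl// ltW.
have [q [k fq]] := sine_poly_approx cf fB L0 e10.
pose t x := q.[sin (k * x)].
pose m x := Num.min 1 ((x / L) ^+ 2).
have [mt [C tC] ct] : test_fun t by exact: test_fun_poly.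
have mm : measurable_fun setT m.
  by apply: measurable_minr => //; apply: measurable_funX; exact: measurable_funM.
have m01 x : `|m x| <= 1.
  by rewrite ger0_norm ?ge_min ?lexx// le_min ler01 sqr_ge0.
have if_ := integrable_bounded mf fB.
have it := integrable_bounded mt tC.
have im := integrable_bounded mm m01.
have BV (r : R) : r <= W / L ^+ 2 -> e1 + 2 * B * r <= 2 * e1.
  move=> rW; rewrite (_ : 2 * e1 = e1 + e1) ?lerD2l; last by ring.
  apply: le_trans BL.
  by rewrite ler_wpM2l ?mulr_ge0.
have hN : `|\int[N]_x f x - \int[N]_x t x| <= 2 * e1.
  rewrite -RintegralB//; apply: le_trans (le_normr_Rintegral _ _) _ => //.
    by have := integrableB measurableT if_ it; apply: eq_integrable.
  have i1 : N.-integrable setT (EFin \o (fun x => e1 + 2 * B * m x)).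
    apply: (@integrable_bounded _ (e1 + 2 * B * 1)).
      by apply: measurable_funD => //; exact: measurable_funM.
    move=> x; apply: le_trans (ler_normD _ _) _; rewrite gtr0_norm// lerD2l.
    by rewrite normrM ger0_norm ?mulr_ge0// ler_wpM2l ?mulr_ge0.
  apply: (@le_trans _ _ (\int[N]_x (e1 + 2 * B * m x))).
    apply: le_Rintegral => //.
      apply: (@integrable_bounded _ (B + C)).
        by apply: measurableT_comp => //; exact: measurable_funB.
      by move=> x; rewrite normr_id; apply: le_trans (ler_normB _ _) _; exact: lerD.
  have i2 : N.-integrable setT (EFin \o (fun x => 2 * B * m x)).
    apply: (@integrable_bounded _ (2 * B * 1)); first exact: measurable_funM.
    by move=> x; rewrite normrM ger0_norm ?mulr_ge0// ler_wpM2l ?mulr_ge0.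
  have i3 : N.-integrable setT (EFin \o (fun=> e1)).
    by apply: (@integrable_bounded _ e1) => // x; rewrite gtr0_norm.
  rewrite RintegralD// RintegralZl// Rintegral_cst//= probability_setT mulr1.
  apply: BV; apply: (@le_trans _ _ (V / L ^+ 2)).
    have := NV L L0; rewrite -[X in (X <= _)%E -> _]fineK ?lee_fin//.
    exact: integrable_fin_num.
  rewrite ler_wpM2r ?invr_ge0 ?(ltW L20)//; apply: le_trans (ler_norm _) _.
  by rewrite lerDl.
have hM n : (0 < n)%N -> `|mX f n - mX t n| <= 2 * e1.
  move=> n0; rewrite -mXB; apply: le_trans (mean_norm _ _ _) _.
  apply: (@le_trans _ _ (mX (fun x => e1 + 2 * B * m x) n)).
    by apply: (mean_le EP) => // p _; exact: fq.
  rewrite mXD mXZ /mX (mean_cst EP)//; apply: BV.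
  have mv := mean_var EP alpha_gt0 alpha_lt1 alpha_theta_gt0 n0.
  apply: (@le_trans _ _ ((L ^+ 2)^-1 * mean P Pi (@stat R alpha (fun x D =>
    D ^+ 2 / x) n))).
    rewrite -meanZ; apply: (mean_le EP) => // p pp; rewrite /stat /m ge_min.
    by rewrite !expr_div_n sqr_sqrtr ?ler0n// mulrC lexx orbT.
  rewrite mulrC ler_wpM2r ?invr_ge0 ?(ltW L20)//; apply: le_trans mv _.
  by apply: le_trans (ler_norm _) _; rewrite lerDr.
have /cvgrPdist_le/(_ _ e10) ct1 := ct.
near=> n; have n0 : (0 < n)%N by near: n; exact: nbhs_infty_gt.
have ht : `|\int[N]_x t x - mX t n| <= e1 by near: n; exact: ct1.
have -> : e = 2 * e1 + e1 + 2 * e1 by rewrite eE; ring.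
rewrite (_ : _ - _ = (\int[N]_x f x - \int[N]_x t x) + (\int[N]_x t x - mX t n) +
  (mX t n - mX f n)); last by ring.
apply: le_trans (ler_normD _ _) _; apply: lerD; last by rewrite distrC hM.
by apply: le_trans (ler_normD _ _) _; exact: lerD.
Unshelve. all: by end_near. Qed.

Lemma cvg_in_law_alpha_hat :
  cvg_in_law P
    (fun n w => Num.sqrt (nblocks (Pi n w))%:R * (alpha_hat R Pi n w - alpha)) N.
Proof.
move=> f cf [M [_ fM]].
have {fM} fB x : `|f x| <= M + 1 by apply: fM => //; rewrite ltrDl.
have mf := continuous_measurable_fun cf.
have -> : (\int[N]_x (f x)%:E = (\int[N]_x f x)%:E)%E.
  by rewrite fineK//; apply: integrable_fin_num => //;
    exact: integrable_bounded mf fB.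
have : (mX f n)%:E @[n --> \oo] --> (\int[N]_x f x)%:E.
  by apply: cvg_EFin; [exact: nearW|exact: cvg_mX cf fB].
apply: cvg_trans; apply: near_eq_cvg; near=> n.
have n0 : (0 < n)%N by near: n; exact: nbhs_infty_gt.
rewrite /mX -(expectation_mean EP)//; congr ('E_P[_])%E; apply/funext => w /=.
(* Both arguments of f equal (S - alpha K) / sqrt K once K > 0, which holds for n > 0. *)
rewrite /stat /alpha_hat; congr f.
set K := _%:R : R; set S := _%:R.
have K0 : 0 < K by rewrite ltr0n nblocks_gt0// (ewens_pitman_partition EP).
have sK : Num.sqrt K != 0 by rewrite gt_eqF// sqrtr_gt0.
have KE := esym (sqr_sqrtr (ltW K0)).
by move: (Num.sqrt K) sK KE => q qn0 ->; field.
Unshelve. all: by end_near. Qed.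

End CentralLimit.

(* The second argument of normal_prob is the standard deviation. *)
Theorem corollary1p3 (d : measure_display) (T : measurableType d)
    (R : realType) (P : probability T R) (alpha theta : R)
    (Pi : forall n : nat, T -> {set {set 'I_n}})
    (alpha_gt0 : 0 < alpha) (alpha_lt1 : alpha < 1)
    (alpha_theta_gt0 : 0 < alpha + theta)
    (EP : ewens_pitman P alpha theta Pi) :
  {ae P, forall w : T, alpha_hat R Pi n w @[n --> \oo] --> alpha} /\
  cvg_in_law P
    (fun n w => Num.sqrt (nblocks (Pi n w))%:R * (alpha_hat R Pi n w - alpha))
    (normal_prob 0 (Num.sqrt (alpha * (1 - alpha)))).
Proof.
split; first exact: alpha_hat_cvg EP alpha_gt0 alpha_lt1 alpha_theta_gt0.
exact: cvg_in_law_alpha_hat EP alpha_gt0 alpha_lt1 alpha_theta_gt0.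
Qed.
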